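(* In the linear regression model with Huber loss described in the context, let $s\geqslant1$ be an integer and suppose that: (2) $\|f_{\theta^*}\|_\infty\leqslant K$; (3) there are constants $c>0$ and $1<\kappa\leqslant2$ with $\|f_\theta-f_{\theta^*}\|\leqslant c\,\mathcal{E}(\theta)^{1/\kappa}$ for every $\theta\in\Theta$; (4) $1\leqslant K,L\leqslant\sqrt{n/\log M}$; (5) (mutual coherence) the Gram matrix $G=(\mathbb{E}[f_j(X)f_k(X)])_{1\leqslant j,k\leqslant M}$ satisfies $G_{j,j}=1$ for all $j$ and $\max_{j\neq k}|G_{j,k}|\leqslant\frac{1}{3\beta s}$ for a constant $\beta>1$; (6) the c.d.f. of $W$ is Lipschitz continuous with constant $1$; (7) $s\leqslant 1/\sqrt r$; (8) $12L^3\eta+L\tilde r+\frac{C_2}{\sqrt n\,s^2}\leqslant\frac{\mathbb{P}(|W|\leqslant2K+\alpha)}{2}$. If $M(\theta^* )\leqslant s$, then on an event of probability at least $1-M^{-1}-M^{-K}-\exp(-\sqrt{\log M})-3M^{-2K}\log\frac{n}{\log M}$ we have $$\sup_{\hat\theta\in\hat\Theta}|\hat\theta-\theta^*|_\infty\leqslant C_4r,\qquad\text{where}\quad C_4=\frac{4+2C_1C_3}{\mathbb{P}(|W|\leqslant2K+\alpha)} .$$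
   Context: Model: $Y=f_{\theta^*}(X)+W$, where $X$ is a random vector in $\mathbb{R}^d$, $W$ is a real random variable independent of $X$ with distribution symmetric about $0$, and $\theta^*\in\mathbb{R}^M$ is unknown; $(X_i,Y_i)$, $i=1,\ldots,n$, are i.i.d. copies of $(X,Y)$. For $g:\mathbb{R}^d\to\mathbb{R}$, $\|g\|_\infty$ is the essential supremum of $|g|$ and $\|g\|=(\mathbb{E}\,g(X)^2)^{1/2}$. The dictionary $f_1,\ldots,f_M$ ($M\geqslant2$) satisfies $\|f_j\|=1$, $\|f_j\|_\infty\leqslant L$. For $\theta\in\mathbb{R}^M$: $f_\theta=\sum_j\theta_jf_j$ and $M(\theta)=|\{j:\theta_j\neq0\}|$; $|\cdot|_1$, $|\cdot|_\infty$ are the $l_1$ and sup norms of vectors. Loss: for constants $K>0$, $\alpha>0$, let $\phi(x)=\frac12x^2$ if $|x|\leqslant2K+\alpha$ and $\phi(x)=(2K+\alpha)|x|-\frac{(2K+\alpha)^2}{2}$ otherwise. Put $Q(z,\theta)=\phi(y-f_\theta(x))$ for $z=(x,y)$, $R(\theta)=\mathbb{E}\,Q((X,Y),\theta)$, $\hat R_n(\theta)=\frac1n\sum_iQ((X_i,Y_i),\theta)$, $\mathcal{E}(\theta)=R(\theta)-R(\theta^* )$. Parameters: $\tilde r=4\sqrt2\,L\frac{\log M}{n}+2\sqrt6\sqrt{\frac{\log M}{n}}$, assumed $\leqslant1$; $r=6\|\phi'\|_\infty\tilde r=6(2K+\alpha)\tilde r$. It is assumed that $\mathbb{P}(|W|\leqslant\alpha)>0$.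 Further, $$C_1=\frac{8(1+2K)\beta}{\mathbb{P}(|W|\leqslant\alpha)(\beta-1)}+\frac16,\qquad \eta=C_1rs,$$ $$C_2=2\sqrt{1+(1+L^2)\Big(8C_1L^3+\frac{4L}{s}\Big)}+\frac{1+L^2}{3},\qquad C_3=\frac{1}{3\beta}+12L^3C_1+\frac{C_2}{\sqrt n\,s}.$$ Estimator: $\Theta=\{\theta\in\mathbb{R}^M:\|f_\theta\|_\infty\leqslant K\}$, and $\hat\Theta$ is the (random) set of all solutions of: minimize $|\theta|_1$ over $\theta\in\Theta$ subject to $|\nabla\hat R_n(\theta)|_\infty\leqslant r$. A supremum over $\hat\Theta$ bounded by a quantity means the bound holds for every $\hat\theta\in\hat\Theta$. *)

(* Defs.v *)
(* MathComp / MathComp-Analysis development over an abstract [R : realType]. *)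
From HB Require Import structures.
From mathcomp Require Export all_boot all_order all_algebra.
From mathcomp Require Export all_classical all_reals all_analysis.

Set Implicit Arguments.
Unset Strict Implicit.
Unset Printing Implicit Defensive.

Export Order.TTheory GRing.Theory Num.Theory.
Export numFieldNormedType.Exports.

Local Open Scope classical_set_scope.
Local Open Scope ring_scope.

Definition independent2 {R : realType} {dT d1 d2 : measure_display}
    {T : measurableType dT} {T1 : measurableType d1} {T2 : measurableType d2}
    (P : probability T R) (U : T -> T1) (V : T -> T2) : Prop :=
  forall (A : set T1) (B : set T2), measurable A -> measurable B ->
    (P (U @^-1` A `&` V @^-1` B) = P (U @^-1` A) * P (V @^-1` B))%E.

(* Subfamilies are covered: the event [B i] may be the whole space. *)
Definition mutually_independent {R : realType} {dT d1 : measure_display}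
    {T : measurableType dT} {T1 : measurableType d1} (n : nat)
    (P : probability T R) (Z : 'I_n -> T -> T1) : Prop :=
  forall B : 'I_n -> set T1, (forall i, measurable (B i)) ->
    (P (\bigcap_(i in [set: 'I_n]) Z i @^-1` B i)
     = \prod_(i < n) P (Z i @^-1` B i))%E.

Definition same_law {R : realType} {dT d1 : measure_display}
    {T : measurableType dT} {T1 : measurableType d1}
    (P : probability T R) (U V : T -> T1) : Prop :=
  forall B : set T1, measurable B -> P (U @^-1` B) = P (V @^-1` B).

Definition iid_copies {R : realType} {dT d1 : measure_display}
    {T : measurableType dT} {T1 : measurableType d1} (n : nat)
    (P : probability T R) (Z0 : T -> T1) (Z : 'I_n -> T -> T1) : Prop :=
  mutually_independent P Z /\ (forall i, same_law P (Z i) Z0).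

Definition symmetric_law {R : realType} {dT : measure_display}
    {T : measurableType dT} (P : probability T R) (W : T -> R) : Prop :=
  same_law P W (fun w => - W w).

Definition prob_abs_le {R : realType} {dT : measure_display}
    {T : measurableType dT} (P : probability T R) (W : T -> R) (a : R) : R :=
  fine (P [set w | `|W w| <= a]).

(* R^d is [d.-tuple R], whose library sigma-algebra is the product of the
   Borel sigma-algebras, i.e. the Borel sigma-algebra of R^d. *)
Definition lincomb {R : realType} {d M : nat}
    (f : 'I_M -> {mfun d.-tuple R >-> R}) (theta : 'rV[R]_M)
    (x : d.-tuple R) : R :=
  \sum_(j < M) theta 0 j * f j x.

Definition sparsity {R : realType} {M : nat} (theta : 'rV[R]_M) : nat :=
  #|[set j : 'I_M | theta 0 j != 0]%SET|.

Definition l1norm {R : realType} {M : nat} (theta : 'rV[R]_M) : R :=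
  \sum_(j < M) `|theta 0 j|.

(* Norms of [g] in L^oo and L^2 of the law of [X]. *)
Definition Linfty_norm {R : realType} {dT : measure_display}
    {T : measurableType dT} {d : nat} (P : probability T R)
    (X : {RV P >-> d.-tuple R}) (g : d.-tuple R -> R) : \bar R :=
  ('N[distribution P X]_(+oo) [EFin \o g])%E.

Definition L2_norm {R : realType} {dT : measure_display}
    {T : measurableType dT} {d : nat} (P : probability T R)
    (X : {RV P >-> d.-tuple R}) (g : d.-tuple R -> R) : \bar R :=
  ('N[distribution P X]_(2%:E) [EFin \o g])%E.

Definition gram {R : realType} {dT : measure_display}
    {T : measurableType dT} {d M : nat} (P : probability T R)
    (X : {RV P >-> d.-tuple R}) (f : 'I_M -> {mfun d.-tuple R >-> R}) :
    'M[R]_M :=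
  \matrix_(j, k) fine 'E_P[(fun w => f j (X w) * f k (X w))%R]%E.

Definition huber {R : realType} (K alpha x : R) : R :=
  if `|x| <= 2 * K + alpha then x ^+ 2 / 2
  else (2 * K + alpha) * `|x| - (2 * K + alpha) ^+ 2 / 2.

Definition Qloss {R : realType} {d M : nat} (K alpha : R)
    (f : 'I_M -> {mfun d.-tuple R >-> R}) (z : d.-tuple R * R)
    (theta : 'rV[R]_M) : R :=
  huber K alpha (z.2 - lincomb f theta z.1).

Definition risk {R : realType} {dT : measure_display}
    {T : measurableType dT} {d M : nat} (K alpha : R) (P : probability T R)
    (f : 'I_M -> {mfun d.-tuple R >-> R}) (X : T -> d.-tuple R) (Y : T -> R)
    (theta : 'rV[R]_M) : \bar R :=
  'E_P[fun w => Qloss K alpha f (X w, Y w) theta]%E.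

(* No moment is assumed on the noise, so both risks may be infinite.  The loss
   being Lipschitz, the loss increment is nevertheless integrable as soon as
   f_theta - f_theta_star is bounded, and its expectation is the difference of
   the risks whenever these are finite: see [excess_risk_riskB]. *)
Definition excess_risk {R : realType} {dT : measure_display}
    {T : measurableType dT} {d M : nat} (K alpha : R) (P : probability T R)
    (f : 'I_M -> {mfun d.-tuple R >-> R}) (X : T -> d.-tuple R) (Y : T -> R)
    (theta_star theta : 'rV[R]_M) : R :=
  fine 'E_P[(fun w => Qloss K alpha f (X w, Y w) theta
                      - Qloss K alpha f (X w, Y w) theta_star)%R]%E.

Lemma excess_risk_riskB {R : realType} {dT : measure_display}
    {T : measurableType dT} {d M : nat} (K alpha : R) (P : probability T R)
    (f : 'I_M -> {mfun d.-tuple R >-> R}) (X : T -> d.-tuple R) (Y : T -> R)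
    (theta_star theta : 'rV[R]_M) :
  P.-integrable setT
    (fun w => (Qloss K alpha f (X w, Y w) theta)%:E) ->
  P.-integrable setT
    (fun w => (Qloss K alpha f (X w, Y w) theta_star)%:E) ->
  excess_risk K alpha P f X Y theta_star theta
  = fine (risk K alpha P f X Y theta)
    - fine (risk K alpha P f X Y theta_star).
Proof.
move=> i1 i2; rewrite /excess_risk /risk !unlock.
rewrite -fineB; [|exact: integrable_fin_num..].
by rewrite -integralB.
Qed.

Definition emp_risk {R : realType} {dT : measure_display}
    {T : measurableType dT} {d M n : nat} (K alpha : R)
    (f : 'I_M -> {mfun d.-tuple R >-> R}) (Xs : 'I_n -> T -> d.-tuple R)
    (Ys : 'I_n -> T -> R) (w : T) (theta : 'rV[R]_M) : R :=
  n%:R^-1 * \sum_(i < n) Qloss K alpha f (Xs i w, Ys i w) theta.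

Definition gradient {R : realType} {M : nat} (F : 'rV[R]_M -> R)
    (theta : 'rV[R]_M) : 'rV[R]_M :=
  \row_(j < M) 'D_(delta_mx 0 j) F theta.

Definition Theta {R : realType} {dT : measure_display}
    {T : measurableType dT} {d M : nat} (K : R) (P : probability T R)
    (X : {RV P >-> d.-tuple R}) (f : 'I_M -> {mfun d.-tuple R >-> R}) :
    set 'rV[R]_M :=
  [set theta | (Linfty_norm X (lincomb f theta) <= K%:E)%E].

(* The norm [`|v|] of [v : 'rV[R]_M] is the sup norm of the library. *)
Definition dantzig_feasible {R : realType} {dT : measure_display}
    {T : measurableType dT} {d M n : nat} (K alpha r : R)
    (P : probability T R) (X : {RV P >-> d.-tuple R})
    (f : 'I_M -> {mfun d.-tuple R >-> R}) (Xs : 'I_n -> T -> d.-tuple R)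
    (Ys : 'I_n -> T -> R) (w : T) : set 'rV[R]_M :=
  [set theta | Theta K X f theta /\
    `|gradient (emp_risk K alpha f Xs Ys w) theta| <= r].

Definition dantzig_solutions {R : realType} {dT : measure_display}
    {T : measurableType dT} {d M n : nat} (K alpha r : R)
    (P : probability T R) (X : {RV P >-> d.-tuple R})
    (f : 'I_M -> {mfun d.-tuple R >-> R}) (Xs : 'I_n -> T -> d.-tuple R)
    (Ys : 'I_n -> T -> R) (w : T) : set 'rV[R]_M :=
  [set theta | dantzig_feasible K alpha r X f Xs Ys w theta /\
    forall theta', dantzig_feasible K alpha r X f Xs Ys w theta' ->
      l1norm theta <= l1norm theta'].

Definition rtilde {R : realType} (L : R) (M n : nat) : R :=
  4 * Num.sqrt 2 * L * (ln M%:R / n%:R)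
  + 2 * Num.sqrt 6 * Num.sqrt (ln M%:R / n%:R).

(* 2K + alpha is the sup norm of the derivative of the Huber loss. *)
Definition rate {R : realType} (K alpha L : R) (M n : nat) : R :=
  6 * (2 * K + alpha) * rtilde L M n.

(* [p] stands for P(|W| <= alpha). *)
Definition C1 {R : realType} (K beta p : R) : R :=
  8 * (1 + 2 * K) * beta / (p * (beta - 1)) + 1 / 6.

Definition eta {R : realType} (K alpha L beta p : R) (M n s : nat) : R :=
  C1 K beta p * rate K alpha L M n * s%:R.

Definition C2 {R : realType} (K L beta p : R) (s : nat) : R :=
  2 * Num.sqrt (1 + (1 + L ^+ 2) *
                    (8 * C1 K beta p * L ^+ 3 + 4 * L / s%:R))
  + (1 + L ^+ 2) / 3.

Definition C3 {R : realType} (K L beta p : R) (s n : nat) : R :=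
  1 / (3 * beta) + 12 * L ^+ 3 * C1 K beta p
  + C2 K L beta p s / (Num.sqrt n%:R * s%:R).

(* [q] stands for P(|W| <= 2K + alpha). *)
Definition C4 {R : realType} (K L beta p q : R) (s n : nat) : R :=
  (4 + 2 * C1 K beta p * C3 K L beta p s n) / q.

(* Main.v *)
(* With W_i = Y_i - f_{theta*}(X_i) and phi' the clipping to [-B, B], B = 2K + alpha,
   everything happens on one event where finitely many empirical means deviate by
   at most 6 rtilde from their expectations (Chernoff's bound for bounded variables
   of second moment at most 1): those of phi'(W) f_j / B, which have mean 0 by
   symmetry of W; of 1{|W| <= a} f_j f_k / L^2 for a = alpha and a = B; and of the
   indicator that W lies within u = L eta of +B or -B, whose mean is at most 4u by (6).
   On that event theta* is feasible, so Delta = theta_hat - theta* satisfies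
   |Delta|_1 <= 2 |Delta_J|_1 with J the support of theta*.  Pairing the difference of
   the two gradients with Delta bounds the mean of 1{|W_i| <= alpha} f_Delta(X_i)^2 by
   2r |Delta|_1, and mutual coherence turns this into |Delta|_1 <= eta, the deviations
   of the truncated Gram matrix being negligible on the cone by (8).  Finally
   phi'(W) - phi'(W - v) equals 1{|W| <= B} v up to an error at most |v| supported where
   W is near +B or -B, so the gradient difference is P(|W| <= B) G Delta up to small
   terms, and coherence isolates Delta_j. *)
From HB Require Import structures.
From mathcomp Require Import simple_functions measurable_realfun ess_sup_inf.
From mathcomp Require Import ring lra zify.
Require Import Defs.

Set Implicit Arguments.
Unset Strict Implicit.
Unset Printing Implicit Defensive.

Local Open Scope classical_set_scope.
Local Open Scope ring_scope.

(** * Independence and exponential moments *)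

Import HBNNSimple.

(** The identity for indicators extends to simple functions by linearity, and to nonnegative [h] by
    monotone convergence along [nnsfun_approx]. In the applications [c] is the expectation of a
    factor [U] independent of [Z]. *)
Lemma ge0_integral_mul_comp {R : realType} {d d1 : measure_display}
    {T : measurableType d} {T1 : measurableType d1}
    (mu : {measure set T -> \bar R}) (Z : T -> T1) (U : T -> R) (c : R)
    (h : T1 -> R) :
  measurable_fun setT Z -> measurable_fun setT U -> measurable_fun setT h ->
  (forall x, 0 <= U x) -> (forall z, 0 <= h z) -> 0 <= c ->
  (forall B, measurable B ->
     \int[mu]_x (U x * \1_B (Z x))%:E = c%:E * mu (Z @^-1` B))%E ->
  (\int[mu]_x (U x * h (Z x))%:E = c%:E * \int[mu]_x (h (Z x))%:E)%E.
Proof.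
move=> mZ mU mh U0 h0 c0 H.
have mh' : measurable_fun setT (fun z => (h z)%:E) by exact/measurable_EFinP.
pose f_ := nnsfun_approx measurableT mh'.
have mf n : measurable_fun setT (f_ n \o Z) by exact: measurableT_comp.
have f_cvg z : (f_ n z)%:E @[n --> \oo] --> (h z)%:E.
  by apply: (cvg_nnsfun_approx measurableT mh') => // y _; rewrite lee_fin.
have f_nd z : nondecreasing_seq (f_^~ z).
  by move=> m n mn; exact/lefP/nd_nnsfun_approx.
have f0 n z : 0 <= f_ n z by [].
transitivity (limn (fun n => \int[mu]_x (U x * f_ n (Z x))%:E))%E.
  rewrite -monotone_convergence//.
  - apply: eq_integral => x _; apply/esym/cvg_lim => //.
    under eq_fun do rewrite EFinM.
    rewrite EFinM; apply: cvgeZl => //.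
  - move=> n; apply/measurable_EFinP; apply: measurable_funM => //; exact: mf.
  - by move=> n x _; rewrite lee_fin mulr_ge0.
  - by move=> x _ m n mn; rewrite lee_fin ler_wpM2l// f_nd.
have fE n : (\int[mu]_x (U x * f_ n (Z x))%:E = c%:E * \int[mu]_x (f_ n (Z x))%:E)%E.
  have mk k : measurable (f_ n @^-1` [set k]) by [].
  have mi k : measurable_fun setT (fun x => \1_(f_ n @^-1` [set k]) (Z x) : R).
    by apply: measurableT_comp => //; exact: measurable_indic.
  transitivity (\int[mu]_x \sum_(k \in range (f_ n))
      (k * (U x * \1_(f_ n @^-1` [set k]) (Z x)))%:E)%E.
    apply: eq_integral => x _; rewrite fsumEFin//; congr EFin.
    rewrite [in LHS]fimfunE mulr_fsumr; apply: eq_fsbigr => k _.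
    by rewrite mulrCA.
  have kg0 k x : (0 <= (k * (U x * \1_(f_ n @^-1` [set k]) (Z x)))%:E)%E.
    rewrite lee_fin indicE; have [|] := boolP (_ \in _); last by rewrite !mulr0.
    by rewrite inE/= => <-; rewrite !mulr_ge0.
  rewrite ge0_integral_fsum//; last first.
    move=> k; apply/measurable_EFinP; apply: measurable_funM => //.
    exact: measurable_funM.
  transitivity (\sum_(k \in range (f_ n)) c%:E * (k%:E * mu (Z @^-1` (f_ n @^-1` [set k]))))%E.
    apply: eq_fsbigr => k; rewrite inE/= => -[z _ <-].
    under eq_integral do rewrite EFinM.
    rewrite ge0_integralZl_EFin//; last 2 first.
    - by move=> x _; rewrite lee_fin mulr_ge0.
    - by apply/measurable_EFinP; exact: measurable_funM.
    by rewrite H// muleCA.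
  rewrite -ge0_mule_fsumr; last first.
    (* Nonnegativity is demanded for every real [k]: off the range of [f_ n] the preimage is empty
       and the term is 0. *)
    move=> k; have [[z _ <-]|kn] := pselect (range (f_ n) k).
      by rewrite mule_ge0// lee_fin.
    rewrite (_ : _ @^-1` (_ @^-1` _) = set0) ?measure0 ?mule0//.
    by apply/seteqP; split => x //= xk; apply: kn; exists (Z x).
  congr (_ * _)%E.
  transitivity (\int[mu]_x \sum_(k \in range (f_ n))
      (k * \1_(f_ n @^-1` [set k]) (Z x))%:E)%E; last first.
    apply: eq_integral => x _; rewrite fsumEFin//; congr EFin.
    by rewrite [in RHS]fimfunE.
  rewrite ge0_integral_fsum//; last 2 first.
  - by move=> k; apply/measurable_EFinP; exact: measurable_funM.
  - move=> k x _; rewrite lee_fin indicE; have [|] := boolP (_ \in _); last by rewrite !mulr0.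
    by rewrite inE/= => <-; rewrite !mulr_ge0.
  apply: eq_fsbigr => k; rewrite inE/= => -[z _ <-].
  under eq_integral do rewrite EFinM.
  rewrite ge0_integralZl_EFin//; last first.
    exact/measurable_EFinP.
  congr (_ * _)%E.
  rewrite (_ : (fun x => _) = (fun x => (\1_(Z @^-1` (f_ n @^-1` [set f_ n z])) x)%:E)).
    rewrite integral_indic ?setIT//.
    by rewrite -[X in measurable X]setTI; exact: mZ.
  by apply/funext => x; rewrite !indicE.
under eq_fun do rewrite fE.
transitivity (c%:E * limn (fun n => \int[mu]_x (f_ n (Z x))%:E))%E.
  rewrite limeMl//; apply: ereal_nondecreasing_is_cvgn => m n mn.
  apply: ge0_le_integral => //.
  - by move=> x _; rewrite lee_fin.
  - apply/measurable_EFinP; exact: mf.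
  - apply/measurable_EFinP; exact: mf.
  - by move=> x _; rewrite lee_fin f_nd.
rewrite -monotone_convergence//.
- congr (_ * _)%E; apply: eq_integral => x _; apply/cvg_lim => //.
- by move=> n; apply/measurable_EFinP; exact: mf.
- by move=> n x _; rewrite lee_fin.
- by move=> x _ m n mn; rewrite lee_fin f_nd.
Qed.

Lemma integral_indicT {R : realType} {d : measure_display} {T : measurableType d}
  (mu : {measure set T -> \bar R}) (A : set T) : measurable A ->
  (\int[mu]_x (\1_A x)%:E = mu A)%E.
Proof. by move=> mA; rewrite integral_indic ?setIT. Qed.

(** This turns independence of events into the factorization of moment generating functions, each
    [h i] being then an exponential. *)
Lemma mutually_independent_prod {R : realType} {d d1 : measure_display}
    {T : measurableType d} {T1 : measurableType d1} (n : nat)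
    (P : probability T R) (Z : 'I_n -> T -> T1) (h : 'I_n -> T1 -> R)
    (e : 'I_n -> R) :
  mutually_independent P Z -> (forall i, measurable_fun setT (Z i)) ->
  (forall i, measurable_fun setT (h i)) -> (forall i z, 0 <= h i z) ->
  (forall i, \int[P]_x (h i (Z i x))%:E = (e i)%:E)%E ->
  (\int[P]_x (\prod_(i < n) h i (Z i x))%:E = (\prod_(i < n) e i)%:E)%E.
Proof.
move=> indZ mZ.
have mpre i B : measurable B -> measurable (Z i @^-1` B).
  by move=> mB; rewrite -[X in measurable X]setTI; exact: mZ.
suff H k : (k <= n)%N -> forall (B : 'I_n -> set T1) (h : 'I_n -> T1 -> R) (e : 'I_n -> R),
    (forall i, measurable (B i)) ->
    (forall i : 'I_n, (k <= i)%N -> h i = \1_(B i)) ->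
    (forall i, measurable_fun setT (h i)) -> (forall i z, 0 <= h i z) ->
    (forall i, \int[P]_x (h i (Z i x))%:E = (e i)%:E)%E ->
    (\int[P]_x (\prod_(i < n) h i (Z i x))%:E = (\prod_(i < n) e i)%:E)%E.
  (* At [k = n] no index is left for an indicator, so [set0] is a dummy value of [B]. *)
  move=> mh h0 he; apply: (H n (leqnn n) (fun=> set0)) => //.
  by move=> i; rewrite leqNgt ltn_ord.
(* The factors are made general one at a time, starting from indicators. *)
elim: k => [|k IH] kn B {}h {}e mB hB mh h0 he.
  have eE i : (e i)%:E = P (Z i @^-1` B i).
    rewrite -he -integral_indicT; last exact: mpre.
    by apply: eq_integral => x _; rewrite hB// !indicE.
  transitivity (P (\bigcap_(i in [set: 'I_n]) Z i @^-1` B i)); last first.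
    rewrite indZ// -prodEFin; apply: eq_bigr => i _; exact/esym/eE.
  rewrite -integral_indicT; last first.
    by apply: fin_bigcap_measurable => // i _; exact: mpre.
  apply: eq_integral => x _; congr EFin.
  rewrite indicE; have [|] := boolP (x \in _).
    rewrite inE => xB; rewrite big1// => i _.
    by rewrite hB// indicE mem_set//; exact: xB.
  rewrite notin_setE/= => /existsNP[i /not_implyP[_ xi]].
  by apply/eqP/prodf_eq0; exists i; rewrite //= hB// indicE memNset.
(* The factor of index [k] is traded for an arbitrary indicator [\1_C], which the induction
   hypothesis covers; [ge0_integral_mul_comp] then passes from all [C] to [h i0], the remaining
   factors forming [U]. *)
pose i0 := Ordinal kn.
pose U x := \prod_(i < n | i != i0) h i (Z i x).
have mhZ i : measurable_fun setT (fun x => h i (Z i x)).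
  by apply: measurableT_comp (mZ i).
have mU : measurable_fun setT U.
  rewrite /U; under eq_fun do rewrite big_mkcond.
  apply: (measurable_prod (h := fun i x => if i != i0 then h i (Z i x) else 1)) => i _.
  by case: (i != i0); [exact: mhZ|exact: measurable_cst].
have e0 i : 0 <= e i.
  by rewrite -lee_fin -he; apply: integral_ge0 => x _; rewrite lee_fin.
under eq_integral do rewrite (bigD1 i0)//= mulrC.
rewrite (bigD1 i0)//= mulrC EFinM -he.
apply: (ge0_integral_mul_comp (U := U)) => //; first by move=> x; exact: prodr_ge0.
  exact: prodr_ge0.
move=> C mC.
pose h' i := if i == i0 then \1_C else h i.
pose e' i := if i == i0 then fine (P (Z i0 @^-1` C)) else e i.
transitivity (\int[P]_x (\prod_(i < n) h' i (Z i x))%:E)%E.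
  apply: eq_integral => x _; rewrite [in RHS](bigD1 i0)//= /h' eqxx mulrC.
  by congr (_ * _)%:E; apply: eq_bigr => i /negbTE ->.
rewrite (IH (ltnW kn) (fun i => if i == i0 then C else B i) h' e').
- rewrite (bigD1 i0)//= /e' eqxx mulrC EFinM fineK; last exact/fin_num_measure/mpre.
  by congr (_%:E * _)%E; apply: eq_bigr => i /negbTE ->.
- by move=> i; case: ifP.
- move=> i; rewrite leq_eqVlt /h' => /predU1P[ki|ki].
    by rewrite ifT ?ifT//; apply/eqP/val_inj.
  by rewrite !ifF//; [exact: hB| |]; apply/negbTE; rewrite -val_eqE/= gtn_eqF.
- by move=> i; rewrite /h'; case: ifP => // _; exact: measurable_indic.
- by move=> i z; rewrite /h'; case: ifP => // _.
- move=> i; rewrite /h' /e'; case: eqP => [->|//].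
  rewrite fineK; last exact/fin_num_measure/mpre.
  rewrite -integral_indicT; last exact: mpre.
  by apply: eq_integral => x _; rewrite !indicE.
Qed.

(** Two passes from indicators to functions: first in [V] with the factor [h1 \o U], then in [U]
    with the factor [\1_B \o V], which leaves the product rule for events. *)
Lemma independent2_ge0_integralM {R : realType} {d d1 d2 : measure_display}
    {T : measurableType d} {T1 : measurableType d1} {T2 : measurableType d2}
    (P : probability T R) (U : T -> T1) (V : T -> T2)
    (h1 : T1 -> R) (h2 : T2 -> R) (e1 : R) :
  independent2 P U V -> measurable_fun setT U -> measurable_fun setT V ->
  measurable_fun setT h1 -> measurable_fun setT h2 ->
  (forall z, 0 <= h1 z) -> (forall z, 0 <= h2 z) ->
  (\int[P]_x (h1 (U x))%:E = e1%:E)%E ->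
  (\int[P]_x (h1 (U x) * h2 (V x))%:E = e1%:E * \int[P]_x (h2 (V x))%:E)%E.
Proof.
move=> indUV mU mV mh1 mh2 h10 h20 he1.
have mpreU B : measurable B -> measurable (U @^-1` B).
  by move=> mB; rewrite -[X in measurable X]setTI; exact: mU.
have mpreV B : measurable B -> measurable (V @^-1` B).
  by move=> mB; rewrite -[X in measurable X]setTI; exact: mV.
apply: (ge0_integral_mul_comp (U := h1 \o U)) => //.
- exact: measurableT_comp.
- by move=> x /=.
- by rewrite -lee_fin -he1; apply: integral_ge0 => x _; rewrite lee_fin.
move=> B mB; rewrite muleC -he1.
rewrite -[X in (X * _)%E]fineK; last exact/fin_num_measure/mpreV.
under eq_integral do rewrite mulrC.
apply: (ge0_integral_mul_comp (U := fun x => \1_B (V x)) (Z := U)) => //.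
  exact: (measurableT_comp (f := \1_B : T2 -> R)).
move=> A mA; rewrite fineK; last exact/fin_num_measure/mpreV.
rewrite muleC -indUV// -integral_indicT; last by apply: measurableI; [exact: mpreU|exact: mpreV].
by apply: eq_integral => x _; rewrite setIC indicI !indicE.
Qed.

(** * Deviations of averages of bounded variables *)

Lemma bounded_integrable {R : realType} {d : measure_display}
    {T : measurableType d} (P : probability T R) (g : T -> R) (b : R) :
  measurable_fun setT g -> (forall x, `|g x| <= b) ->
  P.-integrable setT (EFin \o g).
Proof.
move=> mg gb; apply: measurable_bounded_integrable => //.
  by rewrite (le_lt_trans (probability_le1 _ _)) ?ltry.
by exists b; split; [exact: num_real|move=> M bM x _; exact: (le_trans (gb x) (ltW bM))].
Qed.

(** From [expR (- x) >= 1 - x] one gets [expR x <= 1 / (1 - x)], and [(1 - x) * (1 + x + 2 * x ^+ 2)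
    = 1 + x ^+ 2 * (1 - 2 * x)] is at least 1 in this range. *)
Lemma expR_le_quadratic {R : realType} (x : R) :
  `|x| <= 2^-1 -> expR x <= 1 + x + 2 * x ^+ 2.
Proof.
rewrite ler_norml => /andP[x1 x2].
have e0 := expR_gt0 x.
have := expR_ge1Dx (- x); rewrite expRN => e1.
have e2 : (1 - x) * expR x <= 1 by rewrite -ler_pdivlMr// mul1r.
nra.
Qed.

Lemma same_law_ge0_integral {R : realType} {d d1 : measure_display}
    {T : measurableType d} {T1 : measurableType d1}
    (P : probability T R) (U V : T -> T1) (h : T1 -> R) :
  same_law P U V -> measurable_fun setT U -> measurable_fun setT V ->
  measurable_fun setT h -> (forall z, 0 <= h z) ->
  (\int[P]_x (h (U x))%:E = \int[P]_x (h (V x))%:E)%E.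
Proof.
move=> UV mU mV mh h0.
have mh' : measurable_fun setT (fun z => (h z)%:E) by exact/measurable_EFinP.
have := @ge0_integral_pushforward _ _ _ _ R _ mU P setT (fun z => (h z)%:E) measurableT mh'.
have := @ge0_integral_pushforward _ _ _ _ R _ mV P setT (fun z => (h z)%:E) measurableT mh'.
rewrite !preimage_setT /= => <-; last by move=> y _; rewrite lee_fin.
move=> <-; last by move=> y _; rewrite lee_fin.
by apply: eq_measure_integral => A mA _; exact: UV.
Qed.

(** Integrate the quadratic bound for the exponential, then use [1 + t <= expR t]. The sup bound [b]
    only restricts [l]; the second moment alone enters the exponent. *)
Lemma mgf_le {R : realType} {d : measure_display} {T : measurableType d}
    (P : probability T R) (g : T -> R) (b l : R) :
  measurable_fun setT g -> (forall x, `|g x| <= b) ->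
  \int[P]_x (g x) ^+ 2 <= 1 -> 0 <= l -> l * b <= 2^-1 ->
  \int[P]_x expR (l * g x) <= expR (l * (\int[P]_x g x) + 2 * l ^+ 2).
Proof.
move=> mg gb g2 l0 lb.
have lg x : `|l * g x| <= 2^-1.
  by rewrite normrM ger0_norm// (le_trans _ lb)// ler_wpM2l.
have ig := bounded_integrable P mg gb.
have ig2 : P.-integrable setT (EFin \o (fun x => g x ^+ 2)).
  apply: (@bounded_integrable _ _ _ P _ (b ^+ 2)); first exact: measurable_funX.
  by move=> x; rewrite normrX lerXn2r// nnegrE (le_trans _ (gb x)).
have i1 : P.-integrable setT (EFin \o (fun x => 1 + l * g x)).
  apply: (@bounded_integrable _ _ _ P _ (1 + 2^-1)).
    by apply: measurable_funD => //; exact: measurable_funM.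
  by move=> x; rewrite (le_trans (ler_normD _ _))// normr1 lerD2l.
have i2 : P.-integrable setT (EFin \o (fun x => 2 * l ^+ 2 * g x ^+ 2)).
  apply: (@bounded_integrable _ _ _ P _ (2 * l ^+ 2 * b ^+ 2)).
    by apply: measurable_funM => //; exact: measurable_funX.
  move=> x; rewrite normrM ger0_norm ?mulr_ge0 ?sqr_ge0// ler_wpM2l ?mulr_ge0 ?sqr_ge0//.
  by rewrite normrX lerXn2r// nnegrE (le_trans _ (gb x)).
have ie : P.-integrable setT (EFin \o (fun x => expR (l * g x))).
  apply: (@bounded_integrable _ _ _ P _ (expR (2^-1))).
    by apply: measurableT_comp => //; exact: measurable_funM.
  move=> x; rewrite ger0_norm ?expR_ge0// ler_expR (le_trans (ler_norm _))//.
have il : P.-integrable setT (EFin \o (fun x => l * g x)).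
  apply: (@bounded_integrable _ _ _ P _ (2^-1)) => //; exact: measurable_funM.
have i0 : P.-integrable setT (EFin \o (fun x : T => 1 : R)).
  by apply: (@bounded_integrable _ _ _ P _ (1)) => // x; rewrite normr1.
apply: (@le_trans _ _ (\int[P]_x ((1 + l * g x) + 2 * l ^+ 2 * g x ^+ 2))).
  apply: le_Rintegral => //.
    by have := integrableD measurableT i1 i2; apply: eq_integrable.
  move=> x _; apply: (le_trans (expR_le_quadratic (lg x))).
  by rewrite exprMn mulrA.
rewrite RintegralD//= RintegralD//= !RintegralZl//= Rintegral_cst//.
rewrite [fine _](_ : _ = 1) ?mulr1; last first.
  by rewrite -[RHS]/(fine (1 : \bar R)%E); congr fine; exact: probability_setT.
rewrite (le_trans _ (expR_ge1Dx _))// addrA lerD2l.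
by rewrite ler_piMr// mulr_ge0// sqr_ge0.
Qed.

(** Markov's inequality for the exponential of the sum, whose expectation factors into [n] equal
    ones bounded by [mgf_le]. The parameter [l] stays free and is tuned later. *)
Lemma iid_chernoff {R : realType} {d d1 : measure_display}
    {T : measurableType d} {T1 : measurableType d1} (n : nat)
    (P : probability T R) (Z0 : T -> T1) (Z : 'I_n -> T -> T1)
    (g : T1 -> R) (b l t : R) :
  iid_copies P Z0 Z -> measurable_fun setT Z0 ->
  (forall i, measurable_fun setT (Z i)) ->
  measurable_fun setT g -> (forall z, `|g z| <= b) ->
  \int[P]_x (g (Z0 x)) ^+ 2 <= 1 -> 0 < l -> l * b <= 2^-1 ->
  (P [set x | n%:R * (\int[P]_y g (Z0 y) + t) <= \sum_(i < n) g (Z i x)]%R <=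
    (expR (- (n%:R * (l * (t - 2 * l)))))%:E)%E.
Proof.
move=> [indZ lawZ] mZ0 mZ mg gb g2 l0 lb.
set m := \int[P]_y g (Z0 y).
have mgZ i : measurable_fun setT (g \o Z i) by exact: measurableT_comp.
have mS : measurable_fun setT (fun x => \sum_(i < n) g (Z i x)).
  by apply: (@measurable_sum _ _ _ _ _ _ (fun i x => g (Z i x))) => i; exact: mgZ.
pose S : {RV P >-> R} := HB.pack (fun x => \sum_(i < n) g (Z i x))
  (isMeasurableFun.Build _ _ _ _ _ mS).
have := chernoff S (n%:R * (m + t)) l0.
move/le_trans; apply.
pose h z := expR (l * g z).
have mh : measurable_fun setT h.
  by apply: measurableT_comp => //; exact: measurable_funM.
have hb z : `|h z| <= expR (l * b).
  rewrite ger0_norm ?expR_ge0// ler_expR ler_wpM2l ?(ltW l0)//.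
  exact: le_trans (ler_norm _) (gb z).
have iE : (\int[P]_x (h (Z0 x))%:E)%E = (\int[P]_x h (Z0 x))%:E.
  rewrite /Rintegral fineK//; apply: integrable_fin_num => //.
  apply: (@bounded_integrable _ _ _ P (h \o Z0)); last by move=> x; exact: hb.
  exact: measurableT_comp.
have ME : ('M_P S l = ((\int[P]_x h (Z0 x)) ^+ n)%:E)%E.
  rewrite /mmt_gen_fun unlock.
  transitivity (\int[P]_x (\prod_(i < n) h (Z i x))%:E)%E.
    apply: eq_integral => x _; congr EFin.
    by rewrite /= mulrC mulr_sumr expR_sum.
  rewrite (@mutually_independent_prod _ _ _ _ _ _ P Z (fun=> h)
    (fun=> \int[P]_x h (Z0 x)) indZ mZ)//.
  - by rewrite prodr_const card_ord.
  - by move=> i z; rewrite expR_ge0.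
  - move=> i; rewrite -iE; apply: same_law_ge0_integral => // z.
    by rewrite expR_ge0.
rewrite ME -EFinM lee_fin.
have gZ0 : measurable_fun setT (g \o Z0) by exact: measurableT_comp.
have := @mgf_le _ _ _ P (g \o Z0) b l gZ0 (fun x => gb (Z0 x)) g2 (ltW l0) lb.
rewrite /= -/m => H.
apply: (@le_trans _ _ (expR (l * m + 2 * l ^+ 2) ^+ n * expR (- (l * (n%:R * (m + t)))))).
  rewrite ler_wpM2r ?expR_ge0// lerXn2r// ?nnegrE ?expR_ge0//.
  by apply: Rintegral_ge0 => x _; rewrite expR_ge0.
rewrite -expRM_natl -expRD ler_expR.
by rewrite le_eqVlt; apply/orP; left; apply/eqP; ring.
Qed.

Lemma finite_union_bound {R : realType} {d : measure_display}
    {T : measurableType d} (mu : {measure set T -> \bar R}) (I : finType)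
    (B : I -> set T) (e : R) :
  (forall i, measurable (B i)) -> (forall i, mu (B i) <= e%:E)%E ->
  measurable (\bigcup_i B i) /\
  (mu (\bigcup_i B i) <= (#|I|%:R * e)%:E)%E.
Proof.
move=> mB Be; have mU (s : seq I) : measurable (\bigcup_(i in [set` s]) B i).
  by rewrite bigcup_seq; exact: bigsetU_measurable.
have E : \bigcup_i B i = \bigcup_(i in [set` enum I]) B i.
  by congr bigcup; apply/seteqP; split => i //= _; rewrite mem_enum.
rewrite E; split => //; rewrite cardE.
elim: (enum I) => [|i s IH]; first by rewrite set_nil bigcup_set0 measure0 mul0r.
rewrite bigcup_seq big_cons -bigcup_seq (le_trans (measureU2 _ _ _))//.
by rewrite /= -natr1 mulrDl mul1r addrC EFinD leeD.
Qed.

Lemma iid_uniform_deviation {R : realType} {d d1 : measure_display}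
    {T : measurableType d} {T1 : measurableType d1} (n : nat)
    (P : probability T R) (Z0 : T -> T1) (Z : 'I_n -> T -> T1)
    (I : finType) (g : I -> T1 -> R) (b l t : R) :
  iid_copies P Z0 Z -> measurable_fun setT Z0 ->
  (forall i, measurable_fun setT (Z i)) ->
  (forall j, measurable_fun setT (g j)) -> (forall j z, `|g j z| <= b) ->
  (forall j, \int[P]_x (g j (Z0 x)) ^+ 2 <= 1) -> 0 < l -> l * b <= 2^-1 ->
  exists A : set T,
    [/\ measurable A,
        ((1 - 2 * #|I|%:R * expR (- (n%:R * (l * (t - 2 * l)))))%:E <= P A)%E
      & forall w, A w -> forall j,
          `|\sum_(i < n) g j (Z i w) - n%:R * \int[P]_x g j (Z0 x)| <= n%:R * t].
Proof.
move=> iid mZ0 mZ mg gb g2 l0 lb.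
(* A boolean carries the sign: one-sided bounds over [I * bool] give the two-sided ones, whence the
   factor 2. *)
pose sg (c : bool) : R := if c then -1 else 1.
have sgN c : `|sg c| = 1 by rewrite /sg; case: c; rewrite ?normrN normr1.
have sg2 c : sg c ^+ 2 = 1 by rewrite /sg; case: c; rewrite ?sqrrN expr1n.
pose G (p : I * bool) z := sg p.2 * g p.1 z.
have mG p : measurable_fun setT (G p) by exact: measurable_funM.
have Gb p z : `|G p z| <= b by rewrite normrM sgN mul1r.
pose B p := [set x | n%:R * (\int[P]_y G p (Z0 y) + t) <= \sum_(i < n) G p (Z i x)].
have mB p : measurable (B p).
  rewrite -[X in measurable X]setTI; apply: measurable_fun_le => //.
  apply: (@measurable_sum _ _ _ _ _ _ (fun i x => G p (Z i x))) => i.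
  exact: measurableT_comp.
have PB p : (P (B p) <= (expR (- (n%:R * (l * (t - 2 * l)))))%:E)%E.
  apply: iid_chernoff lb => //.
  under eq_Rintegral do rewrite /G exprMn sg2 mul1r.
  exact: g2.
have [mU PU] := finite_union_bound mB PB.
exists (~` \bigcup_p B p); split.
- exact: measurableC.
- rewrite probability_setC// EFinB leeB//.
  by rewrite (le_trans PU)// card_prod card_bool lee_fin natrM [_ * 2]mulrC.
- move=> w Aw j.
  have H c : \sum_(i < n) G (j, c) (Z i w) <= n%:R * (\int[P]_y G (j, c) (Z0 y) + t).
    by rewrite leNgt; apply/negP => /ltW h; apply: Aw; exists (j, c).
  have ig : P.-integrable setT (EFin \o (g j \o Z0)).
    apply: (@bounded_integrable _ _ _ P _ b) => [|x]; last exact: gb.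
    exact: measurableT_comp.
  have IG c : \int[P]_y G (j, c) (Z0 y) = sg c * \int[P]_y g j (Z0 y).
    by rewrite -RintegralZl.
  have SG c : \sum_(i < n) G (j, c) (Z i w) = sg c * \sum_(i < n) g j (Z i w).
    by rewrite mulr_sumr.
  have := H true; have := H false; rewrite !IG !SG /sg => H1 H2.
  rewrite ler_norml; apply/andP; split; lra.
Qed.

(** * The Huber loss *)

Definition clip {R : realType} (B x : R) : R := Num.max (- B) (Num.min B x).

(** The kinks of [clip B] are at [B] and [- B]. The windows are half-open so that their
    probabilities are increments of the cdf. *)
Definition near_kink {R : realType} (B u w : R) : bool :=
  (B - u < w <= B + u) || (- B - u < w <= - B + u).

Lemma clip_spec {R : realType} (B x : R) : 0 <= B ->
  [\/ clip B x = B /\ B <= x, clip B x = - B /\ x <= - B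
    | clip B x = x /\ - B <= x <= B].
Proof.
move=> B0; rewrite /clip minEle maxEle; case: (leP B x) => Bx.
  by apply: Or31; split => //; rewrite ifT// (le_trans _ B0)// oppr_le0.
case: (leP (- B) x) => Bx2; last by apply: Or32; split => //; rewrite ltW.
by apply: Or33; rewrite ltW.
Qed.

Lemma norm_clip {R : realType} (B x : R) : 0 <= B -> `|clip B x| <= B.
Proof.
move=> B0; rewrite ler_norml; case: (clip_spec x B0) => -[-> ?]; apply/andP; split; lra.
Qed.

Lemma clipN {R : realType} (B x : R) : 0 <= B -> clip B (- x) = - clip B x.
Proof.
move=> B0; case: (clip_spec x B0) => -[-> ?]; case: (clip_spec (- x) B0) => -[-> ?]; lra.
Qed.

Lemma measurable_clip {R : realType} (B : R) : measurable_fun setT (clip B).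
Proof. by apply: measurable_maxr => //; exact: measurable_minr. Qed.

(** If [|w| <= a], both [w] and [w - v] lie in [[-B, B]], where [clip B] is the identity, and
    equality holds. Otherwise the right-hand side is nonnegative because [clip B] is
    nondecreasing. *)
Lemma clip_increment_ge {R : realType} (B a k w v : R) : 0 <= B -> B = 2 * k + a -> `|v| <= 2 * k ->
  (`|w| <= a)%R%:R * v ^+ 2 <= (clip B w - clip B (w - v)) * v.
Proof.
move=> B0; rewrite ler_norml => BE vk; case: (leP `|w| a) => [|_].
  rewrite ler_norml mul1r => wa.
  case: (clip_spec w B0) => -[-> ?]; case: (clip_spec (w - v) B0) => -[-> ?]; nra.
rewrite mul0r.
case: (clip_spec w B0) => -[-> ?]; case: (clip_spec (w - v) B0) => -[-> ?]; nra.
Qed.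

(** Away from the windows [w] and [w - v] are on the same side of each kink and the error vanishes.
    Inside them both the increment and its linearization lie between 0 and [v], as [clip B] is
    nondecreasing and 1-Lipschitz. *)
Lemma clip_linearization {R : realType} (B u w v : R) : 0 <= B -> `|v| <= u ->
  `|clip B w - clip B (w - v) - (`|w| <= B)%R%:R * v| <= `|v| * (near_kink B u w)%:R.
Proof.
move=> B0 vu; have [nk|] := boolP (near_kink B u w).
  rewrite mulr1 ler_norml; move: nk => _.
  have v1 := ler_norm v; have v2 := ler_norm (- v); rewrite normrN in v2.
  case: (leP `|w| B) => [|]; rewrite ?mul1r ?mul0r ?subr0.
    rewrite ler_norml => wB.
    case: (clip_spec w B0) => -[-> ?];
      case: (clip_spec (w - v) B0) => -[-> ?]; apply/andP; split; lra.
  rewrite ltr_normr => /orP wB.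
  case: (clip_spec w B0) => -[-> ?];
    case: (clip_spec (w - v) B0) => -[-> ?]; apply/andP; split; case: wB => wB; lra.
move=> nk; rewrite mulr0 normr_le0; apply/eqP; move: nk.
rewrite /near_kink negb_or !negb_and -!leNgt -!ltNge => /andP[/orP n1 /orP n2].
move: vu; rewrite ler_norml => vu.
case: (leP `|w| B); rewrite ?ler_norml ?ltr_normr ?mul1r ?mul0r ?subr0 => wB.
  case: (clip_spec w B0) => -[-> ?]; case: (clip_spec (w - v) B0) => -[-> ?];
    case: n1 => ?; case: n2 => ?; lra.
move/orP : wB => wB.
case: (clip_spec w B0) => -[-> ?]; case: (clip_spec (w - v) B0) => -[-> ?];
  case: n1 => ?; case: n2 => ?; case: wB => ?; lra.
Qed.

(** The loss is the maximum of [c * x - c ^+ 2 / 2] over [|c| <= B], attained at [c = clip B x]; one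
    formula thus covers both branches. *)
Lemma huberE {R : realType} (K alpha x : R) (B := 2 * K + alpha) : 0 <= B ->
  huber K alpha x = clip B x * x - clip B x ^+ 2 / 2.
Proof.
move=> B0; rewrite /huber -/B; case: (clip_spec x B0) => -[-> xB].
- case: (leP `|x| B) => [|_]; last by rewrite ger0_norm// (le_trans B0).
  by rewrite ler_norml => xB'; have -> : x = B by [lra|]; field.
- case: (leP `|x| B) => [|_]; last by rewrite ler0_norm; [ring|lra].
  by rewrite ler_norml => xB'; have -> : x = - B by [lra|]; field.
- by rewrite -ler_norml in xB; rewrite xB; field.
Qed.

Lemma huber_taylor {R : realType} (K alpha x y : R) : 0 <= 2 * K + alpha ->
  `|huber K alpha y - huber K alpha x - clip (2 * K + alpha) x * (y - x)|
  <= (y - x) ^+ 2.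
Proof.
move=> B0; rewrite !huberE//; move: (2 * K + alpha) B0 => B B0.
(* Variational inequality of the projection [clip B v] onto [[-B, B]], tested at the point
   [clip B u]. It is used in both directions. *)
have H (u v : R) : 0 <= (clip B v - clip B u) * (v - clip B v).
  case: (clip_spec u B0) => -[-> hu]; case: (clip_spec v B0) => -[-> hv]; nra.
have H1 := H x y; have H2 := H y x.
move: (clip B x) (clip B y) H1 H2 => a b H1 H2.
have := sqr_ge0 (y - b + (a - x)); have := sqr_ge0 (b - a).
rewrite ler_norml => h1 h2; apply/andP; split; nra.
Qed.

(** * Gradient of the empirical risk *)

(** The difference quotient stays within [C * |h|] of [S]. A quadratic remainder thus yields the
    derivative of the loss without any case analysis at the kinks. *)
Lemma derive_quadratic_remainder {R : realType} (V : normedModType R)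
    (F : V -> R) (a v : V) (S C : R) :
  (forall h, `|F (h *: v + a) - F a - h * S| <= C * h ^+ 2) -> 'D_v F a = S.
Proof.
move=> H; apply/cvg_lim => //; apply/cvgrPdist_le => e e0.
have C0 : 0 <= C by have := H 1; rewrite expr1n mulr1; apply: le_trans.
near=> h.
have h0 : h != 0 by near: h; exact: nbhs_dnbhs_neq.
(* [C + 1] instead of [C] keeps the divisor positive when [C = 0]. *)
have he : (C + 1) * `|h| <= e.
  rewrite mulrC -ler_pdivlMr; last lra.
  near: h; apply: dnbhs0_le; rewrite divr_gt0//; lra.
rewrite /= -[leLHS]normrN opprB.
have -> : h^-1 *: (F (h *: v + a) - F a) - S = h^-1 * (F (h *: v + a) - F a - h * S).
  by rewrite /GRing.scale/=; field.
rewrite normrM normfV ler_pdivrMl ?normr_gt0//.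
rewrite (le_trans (H h))// -[h ^+ 2]ger0_norm ?sqr_ge0// normrX expr2 mulrA mulrC ler_wpM2l//.
rewrite (le_trans _ he)// ler_wpM2r//; lra.
Unshelve. all: by end_near. Qed.

Lemma lincombDZ {R : realType} {d M : nat} (f : 'I_M -> {mfun d.-tuple R >-> R})
    (u v : 'rV[R]_M) (h : R) x :
  lincomb f (h *: u + v) x = h * lincomb f u x + lincomb f v x.
Proof.
rewrite /lincomb mulr_sumr -big_split; apply: eq_bigr => j _.
by rewrite !mxE /= mulrDl mulrA.
Qed.

Lemma lincomb_delta {R : realType} {d M : nat}
    (f : 'I_M -> {mfun d.-tuple R >-> R}) (j : 'I_M) x :
  lincomb f (delta_mx 0 j) x = f j x.
Proof.
rewrite /lincomb (bigD1 j)//= big1 ?addr0 ?mxE ?eqxx ?mul1r// => k /negbTE kj.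
by rewrite mxE kj andbF mul0r.
Qed.

Lemma gradient_emp_riskE {R : realType} {dT : measure_display}
    {T : measurableType dT} {d M n : nat} (K alpha : R)
    (f : 'I_M -> {mfun d.-tuple R >-> R}) (Xs : 'I_n -> T -> d.-tuple R)
    (Ys : 'I_n -> T -> R) (w : T) (theta : 'rV[R]_M) (j : 'I_M) :
  0 <= 2 * K + alpha ->
  gradient (emp_risk K alpha f Xs Ys w) theta 0 j =
  - (n%:R^-1 * \sum_(i < n) clip (2 * K + alpha) (Ys i w - lincomb f theta (Xs i w))
               * f j (Xs i w)).
Proof.
move=> B0; rewrite mxE.
(* Along the coordinate [j] the residual moves by [- h * f j], so the remainders of [huber_taylor]
   average to [h ^+ 2] times the empirical second moment of [f j]. *)
apply: (@derive_quadratic_remainder _ _ _ _ _ _ (n%:R^-1 * \sum_(i < n) (f j (Xs i w)) ^+ 2)) => h.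
rewrite /emp_risk -mulrBr mulrN opprK mulrCA -mulrDr normrM ger0_norm ?invr_ge0//.
rewrite -mulrA ler_wpM2l ?invr_ge0// -sumrB mulr_sumr -big_split/= mulr_suml.
rewrite (le_trans (ler_norm_sum _ _ _))//; apply: ler_sum => i _.
rewrite /Qloss /= lincombDZ lincomb_delta.
set y := Ys i w; set t := lincomb f theta _; set g := f j _.
have := huber_taylor (y - t) (y - (h * g + t)) B0.
by rewrite (_ : y - (h * g + t) - (y - t) = - (h * g)) ?sqrrN ?exprMn; last ring;
  rewrite mulrN opprK (mulrCA (clip _ _) h g) [g ^+ 2 * _]mulrC.
Qed.

(** * Error bounds for a fixed sample *)

(** Cauchy-Schwarz, read off from the nonnegative sum of the squares [(x j - t) ^+ 2] with
    [t = N / s]; the bound [#|J| <= s] enters through the term in [t ^+ 2]. *)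
Lemma sqr_sum_le_card {R : realFieldType} {I : finType} (J : {set I})
    (x : I -> R) (s : nat) : (#|J| <= s)%N ->
  (\sum_(j in J) x j) ^+ 2 <= s%:R * \sum_(j in J) x j ^+ 2.
Proof.
move=> Js; have [s0|s0] := posnP s.
  by rewrite s0 leqn0 cards_eq0 in Js; rewrite (eqP Js) !big_set0 expr0n mulr0.
set N := \sum_(j in J) x j; pose t := N / s%:R.
have s0' : 0 < s%:R :> R by rewrite ltr0n.
have Nt : N = t * s%:R by rewrite /t; field; rewrite pnatr_eq0 -lt0n.
have : 0 <= \sum_(j in J) (x j - t) ^+ 2 by apply: sumr_ge0 => j _; exact: sqr_ge0.
rewrite (eq_bigr (fun j => x j ^+ 2 + (- (2 * t) * x j + t ^+ 2))); last first.
  by move=> j _; ring.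
rewrite 2!big_split/= -mulr_sumr -/N sumr_const -[t ^+ 2 *+ _]mulr_natr.
set N2 := \sum_(j in J) _ => h.
have : t ^+ 2 * #|J|%:R <= t ^+ 2 * s%:R by rewrite ler_wpM2l ?sqr_ge0// ler_nat.
rewrite Nt in h *; nra.
Qed.

(** Pairing the gradient difference with [D] bounds the truncated quadratic form above by
    [rho * D1 <= 2 * rho * N1] and below by [p * N2 - 3 * eps * N1 ^+ 2]. With [N1 ^+ 2 <= s * N2]
    this gives [gam * N2 <= 4 * rho * N1], hence [gam * N1 <= 4 * rho * s]; the cone condition costs
    a last factor 2. *)
Lemma cone_l1_bound {R : realType} {n M s : nat} (F : 'I_n -> 'I_M -> R)
    (W : 'I_n -> R) (D : 'I_M -> R) (J : {set 'I_M})
    (B k a p gam eps rho : R) (v := fun i => \sum_(j < M) D j * F i j) :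
  0 <= B -> B = 2 * k + a -> 0 <= gam -> 0 <= eps -> 0 <= rho ->
  (forall i, `|v i| <= 2 * k) ->
  (forall j, `|n%:R^-1 * \sum_(i < n) (clip B (W i) - clip B (W i - v i)) * F i j|
             <= rho) ->
  (forall j l, `|n%:R^-1 * (\sum_(i < n) (`|W i| <= a)%R%:R * (F i j * F i l))
                 - p * (j == l)%:R| <= eps) ->
  (#|J| <= s)%N ->
  \sum_(j in ~: J) `|D j| <= \sum_(j in J) `|D j| ->
  gam / 2 + 3 * eps * s%:R <= p ->
  gam * \sum_(j < M) `|D j| <= 8 * rho * s%:R.
Proof.
move=> B0 BE gam0 eps0 rho0 vk H1 H2 Js cone hp.
have splitJ (g : 'I_M -> R) : \sum_(j < M) g j = \sum_(j in J) g j + \sum_(j in ~: J) g j.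
  by rewrite (bigID (mem J))/=; congr (_ + _); apply: eq_bigl => j; rewrite inE.
set D1 := \sum_(j < M) `|D j|.
set N1 := \sum_(j in J) `|D j| in cone *.
pose N2 := \sum_(j in J) D j ^+ 2.
pose G j l := n%:R^-1 * (\sum_(i < n) (`|W i| <= a)%R%:R * (F i j * F i l)).
have D1N : D1 <= 2 * N1 by rewrite /D1 splitJ -/N1; lra.
have upper : n%:R^-1 * (\sum_(i < n) (`|W i| <= a)%R%:R * v i ^+ 2) <= rho * D1.
  apply: (@le_trans _ _ (\sum_(j < M) D j *
      (n%:R^-1 * \sum_(i < n) (clip B (W i) - clip B (W i - v i)) * F i j))).
    under [leRHS]eq_bigr do rewrite mulrCA.
    rewrite -mulr_sumr ler_wpM2l ?invr_ge0//.
    under [leRHS]eq_bigr do rewrite mulr_sumr.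
    rewrite exchange_big/=; apply: ler_sum => i _.
    under [leRHS]eq_bigr do rewrite mulrCA.
    by rewrite -mulr_sumr; exact: clip_increment_ge (vk i).
  rewrite mulr_sumr; apply: ler_sum => j _.
  by rewrite (le_trans (ler_norm _))// normrM mulrC ler_wpM2r.
(* [(x + y)^2 >= x (x + 2 y)] with [x], [y] the parts of [v i] supported in and off
   [J]: the off-support block of the empirical Gram matrix is simply dropped. *)
pose c l : R := if l \in J then 1 else 2.
have lower : p * N2 - 3 * eps * N1 ^+ 2
    <= n%:R^-1 * (\sum_(i < n) (`|W i| <= a)%R%:R * v i ^+ 2).
  apply: (@le_trans _ _ (\sum_(j in J) \sum_(l < M) c l * (D j * D l) * G j l)); last first.
    rewrite [leLHS](_ : _ = n%:R^-1 * \sum_(i < n) (`|W i| <= a)%R%:R *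
        ((\sum_(j in J) D j * F i j) * (\sum_(l < M) c l * (D l * F i l)))); last first.
      rewrite mulr_sumr; under eq_bigr do under eq_bigr do rewrite /G mulrCA mulr_sumr mulr_sumr.
      under [RHS]eq_bigr do rewrite mulr_suml mulr_sumr mulr_sumr.
      rewrite [RHS]exchange_big; apply: eq_bigr => j _.
      rewrite exchange_big; apply: eq_bigr => i _.
      rewrite mulr_sumr mulr_sumr mulr_sumr; apply: eq_bigr => l _; ring.
    rewrite ler_wpM2l ?invr_ge0//; apply: ler_sum => i _; rewrite ler_wpM2l//.
    rewrite /v (splitJ (fun l => D l * F i l)) (splitJ (fun l => c l * (D l * F i l))).
    set x := \sum_(j in J) D j * F i j; set y := \sum_(j in ~: J) D j * F i j.
    rewrite [X in x * (X + _)](_ : _ = x); last first.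
      by apply: eq_bigr => l lJ; rewrite /c lJ mul1r.
    rewrite [X in x * (_ + X)](_ : _ = 2 * y); last first.
      by rewrite mulr_sumr; apply: eq_bigr => l; rewrite inE /c => /negbTE ->.
    by have := sqr_ge0 y; nra.
  (* The 3 comes from the cone: the weights [c l] sum [|D l|] to [N1] on [J] and to at most [2 * N1]
     off [J]. *)
  apply: (@le_trans _ _ (\sum_(j in J) (p * D j ^+ 2 - eps * `|D j| * (3 * N1)))).
    rewrite sumrB -mulr_sumr -/N2 -mulr_suml -mulr_sumr -/N1 lerD2l lerN2.
    by rewrite le_eqVlt; apply/orP; left; apply/eqP; ring.
  apply: ler_sum => j jJ.
  apply: (@le_trans _ _ (\sum_(l < M) (p * (j == l)%:R * (D j * D l)
      - eps * `|D j| * (c l * `|D l|)))).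
    rewrite sumrB -mulr_sumr lerB//.
      rewrite (bigD1 j)//= eqxx mulr1 big1 ?addr0 ?expr2// => l.
      by rewrite eq_sym => /negbTE ->; rewrite mulr0 mul0r.
    rewrite ler_wpM2l ?mulr_ge0// splitJ.
    rewrite (eq_bigr (fun l => `|D l|)); last by move=> l lJ; rewrite /c lJ mul1r.
    rewrite -/N1 (eq_bigr (fun l => 2 * `|D l|)); last first.
      by move=> l; rewrite inE /c => /negbTE ->.
    by rewrite -mulr_sumr; lra.
  apply: ler_sum => l _.
  (* The diagonal term only occurs for [l = j] in [J], where the weight is 1, so [c l] factors out
     of the whole comparison. *)
  have c1 : c l * (p * (j == l)%:R * (D j * D l)) = p * (j == l)%:R * (D j * D l).
    case: eqP => [<-|_]; last by rewrite mulr0 mul0r mulr0.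
    by rewrite /c jJ mul1r.
  rewrite -c1.
  have c0 : 0 <= c l by rewrite /c; case: ifP.
  rewrite [eps * _ * _]mulrCA -[c l * _ * _]mulrA -mulrBr ler_wpM2l//.
  rewrite lerBlDr -lerBlDl.
  have -> : p * (j == l)%:R * (D j * D l) - D j * D l * G j l
          = - ((G j l - p * (j == l)%:R) * (D j * D l)) by ring.
  rewrite (le_trans (ler_norm _))// normrN !normrM -mulrA.
  by rewrite ler_wpM2r ?mulr_ge0//; exact: H2.
have CS : N1 ^+ 2 <= s%:R * N2.
  rewrite /N1 /N2; under [X in _ * X]eq_bigr do rewrite -real_normK ?num_real//.
  exact: sqr_sum_le_card.
have N10 : 0 <= N1 by exact: sumr_ge0.
have N20 : 0 <= N2 by apply: sumr_ge0 => j _; exact: sqr_ge0.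
have s0 : 0 <= s%:R :> R by [].
have main : gam * N2 <= 4 * rho * N1.
  have : 3 * eps * N1 ^+ 2 <= 3 * eps * (s%:R * N2) by rewrite ler_wpM2l// mulr_ge0.
  have : (gam / 2 + 3 * eps * s%:R) * N2 <= p * N2 by rewrite ler_wpM2r.
  have : rho * D1 <= rho * (2 * N1) by rewrite ler_wpM2l.
  nra.
have main2 : gam * N1 <= 4 * rho * s%:R.
  have [->|N1n0] := eqVneq N1 0; first by rewrite mulr0 !mulr_ge0.
  have N1p : 0 < N1 by rewrite lt_neqAle eq_sym N1n0.
  rewrite -(ler_pM2r N1p).
  have : gam * N1 ^+ 2 <= gam * (s%:R * N2) by rewrite ler_wpM2l.
  have : s%:R * (gam * N2) <= s%:R * (4 * rho * N1) by rewrite ler_wpM2l.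
  nra.
have : gam * D1 <= gam * (2 * N1) by rewrite ler_wpM2l.
lra.
Qed.

(** Three replacements lead from the gradient difference to [q * D j]: linearizing [clip B] costs
    [L ^+ 2 * D1 * tau] through the samples near a kink, passing to the expected Gram matrix costs
    [delta * D1], and dropping its off-diagonal entries costs [q * om * D1]. *)
Lemma coherence_sup_bound {R : realType} {n M : nat} (F : 'I_n -> 'I_M -> R)
    (W : 'I_n -> R) (D : 'I_M -> R) (G : 'I_M -> 'I_M -> R)
    (B L q om delta tau u rho : R) (v := fun i => \sum_(j < M) D j * F i j)
    (D1 := \sum_(j < M) `|D j|) (j : 'I_M) :
  0 <= B -> 0 <= q -> 0 <= L -> 0 <= om -> L * D1 <= u ->
  (forall i j, `|F i j| <= L) ->
  `|n%:R^-1 * \sum_(i < n) (clip B (W i) - clip B (W i - v i)) * F i j| <= rho ->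
  (forall l, `|n%:R^-1 * (\sum_(i < n) (`|W i| <= B)%R%:R * (F i l * F i j))
               - q * G l j| <= delta) ->
  n%:R^-1 * (\sum_(i < n) (near_kink B u (W i))%:R) <= tau ->
  G j j = 1 -> (forall l, l != j -> `|G l j| <= om) ->
  q * `|D j| <= rho + L ^+ 2 * D1 * tau + delta * D1 + q * om * D1.
Proof.
move=> B0 q0 L0 om0 Lu FL H1 H2 H3 G1 Gom.
have D10 : 0 <= D1 by exact: sumr_ge0.
have vL i : `|v i| <= L * D1.
  rewrite (le_trans (ler_norm_sum _ _ _))// mulr_sumr; apply: ler_sum => l _.
  by rewrite normrM mulrC ler_wpM2r.
pose S := n%:R^-1 * \sum_(i < n) (`|W i| <= B)%R%:R * v i * F i j.
have SE : `|S| <= rho + L ^+ 2 * D1 * tau.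
  have -> : S = n%:R^-1 * (\sum_(i < n) (clip B (W i) - clip B (W i - v i)) * F i j)
      - n%:R^-1 * (\sum_(i < n) (clip B (W i) - clip B (W i - v i)
                                 - (`|W i| <= B)%R%:R * v i) * F i j).
    rewrite -mulrBr -sumrB; congr (_ * _); apply: eq_bigr => i _; ring.
  rewrite (le_trans (ler_normB _ _))// lerD//.
  rewrite normrM ger0_norm ?invr_ge0//.
  apply: (@le_trans _ _ (n%:R^-1 * (\sum_(i < n) L ^+ 2 * D1 * (near_kink B u (W i))%:R))).
    rewrite ler_wpM2l ?invr_ge0// (le_trans (ler_norm_sum _ _ _))//; apply: ler_sum => i _.
    rewrite normrM (@le_trans _ _ (`|v i| * (near_kink B u (W i))%:R * L))//.
      by apply: ler_pM => //; apply: clip_linearization => //; exact: le_trans Lu.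
    rewrite mulrAC ler_wpM2r//.
    by have := vL i; nra.
  by rewrite -mulr_sumr mulrCA ler_wpM2l// mulr_ge0 ?sqr_ge0.
pose Q := \sum_(l < M) D l * (q * G l j).
have SQ : `|S - Q| <= delta * D1.
  have -> : S = \sum_(l < M) D l * (n%:R^-1 * (\sum_(i < n) (`|W i| <= B)%R%:R * (F i l * F i j))).
    under eq_bigr do rewrite mulrCA mulr_sumr.
    rewrite -mulr_sumr exchange_big/=; congr (_ * _); apply: eq_bigr => i _.
    by rewrite /v mulr_sumr mulr_suml; apply: eq_bigr => l _; ring.
  rewrite /Q -sumrB (le_trans (ler_norm_sum _ _ _))// mulr_sumr; apply: ler_sum => l _.
  by rewrite -mulrBr normrM mulrC ler_wpM2r.
have QD : `|Q - q * D j| <= q * om * D1.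
  rewrite /Q (bigD1 j)//= G1 mulr1 mulrC addrAC subrr add0r.
  rewrite (le_trans (ler_norm_sum _ _ _))//.
  have -> : D1 = `|D j| + \sum_(l < M | l != j) `|D l| by rewrite /D1 (bigD1 j).
  rewrite mulrDr.
  rewrite mulr_sumr ler_wpDl ?mulr_ge0//.
  apply: ler_sum => l lj; rewrite normrM mulrC ler_wpM2r// normrM ger0_norm//.
  by rewrite ler_wpM2l// Gom.
rewrite -[X in X * `|_|](ger0_norm q0) -normrM.
have -> : q * D j = S - (S - Q) - (Q - q * D j) by ring.
rewrite (le_trans (ler_normB _ _))// lerD// (le_trans (ler_normB _ _))// lerD//.
Qed.

(** * Expectations in the regression model *)

Lemma Linfty_normP {R : realType} {dT : measure_display}
    {T : measurableType dT} {d : nat} (P : probability T R)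
    (X : {RV P >-> d.-tuple R}) (g : d.-tuple R -> R) (K : R) :
  (Linfty_norm X g <= K%:E)%E <-> \forall x \ae distribution P X, `|g x| <= K.
Proof.
rewrite /Linfty_norm unlock ifT; last first.
  by rewrite [X in (_ < X)%E](probability_setT (distribution P X)) lte01.
by split => [/ess_supP|] H; [|apply/ess_supP]; apply: filterS H => x /=; rewrite lee_fin.
Qed.

Lemma norm_lincomb_le {R : realType} {d M : nat} (f : 'I_M -> {mfun d.-tuple R >-> R})
    (theta : 'rV[R]_M) (L e : R) x : 0 <= L -> 0 <= e ->
  (forall j, `|f j x| <= L) -> (forall j, `|theta 0 j| <= e) ->
  `|lincomb f theta x| <= M%:R * (e * L).
Proof.
move=> L0 e0 fL te; rewrite (le_trans (ler_norm_sum _ _ _))//.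
apply: (@le_trans _ _ (\sum_(j < M) e * L)).
  by apply: ler_sum => j _; rewrite normrM ler_pM.
by rewrite sumr_const card_ord mulr_natl.
Qed.

(** The estimator depends on the sample, so a single null set must serve the uncountably many
    elements of [Theta] at once. *)
Lemma full_measure_bound_set {R : realType} {dT : measure_display}
    {T : measurableType dT} {d M : nat} (P : probability T R)
    (X : {RV P >-> d.-tuple R}) (f : 'I_M -> {mfun d.-tuple R >-> R}) (K L : R) :
  0 < K -> 0 < L -> (forall j, (Linfty_norm X (f j) <= L%:E)%E) ->
  exists G : set (d.-tuple R),
    [/\ measurable G, P (X @^-1` (~` G)) = 0%E,
        (forall x j, G x -> `|f j x| <= L)
      & (forall x theta, G x -> Theta K X f theta -> `|lincomb f theta x| <= K)].
Proof.
move=> K0 L0 hfL.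
have aef : \forall x \ae distribution P X, forall j, `|f j x| <= L.
  have H j := (Linfty_normP X (f j) L).1 (hfL j).
  by apply: filter_forall => j; exact: H.
pose th (q : 'rV[rat]_M) : 'rV[R]_M := map_mx ratr q.
have aeq : \forall x \ae distribution P X, forall n (q : 'rV[rat]_M),
    unpickle n = Some q -> Theta K X f (th q) -> `|lincomb f (th q) x| <= K.
  apply/ae_foralln => n; case: (unpickle n) => [q|]; last by apply: aeW.
  have [Tq|Tq] := pselect (Theta K X f (th q)); last first.
    by apply: aeW => x q' [<-] /Tq.
  have := (Linfty_normP X (lincomb f (th q)) K).1 Tq.
  by apply: filterS => x Hx q' [<-].
have [N [mN N0 NS]] := filterI aef aeq.
exists (~` N); split; [exact: measurableC|by rewrite setCK| |].
  move=> x j Nx; apply: contrapT => h; apply: Nx; apply: NS => -[/(_ j) hx _]; exact: h.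
move=> x theta Nx Tt.
have [fx qx] : (forall j, `|f j x| <= L) /\
    forall q, Theta K X f (th q) -> `|lincomb f (th q) x| <= K.
  have [h1 h2] : ((forall j, `|f j x| <= L) /\ (forall n (q : 'rV[rat]_M),
    unpickle n = Some q -> Theta K X f (th q) -> `|lincomb f (th q) x| <= K)).
    by apply: contrapT => h; apply: Nx; exact: NS.
  split => // q; apply: (h2 (pickle q)); exact: pickleK.
(* Shrinking [theta] by [1 - e] leaves room for a rational approximation that is
   still in [Theta], so countably many null sets suffice. *)
have H (e : R) : 0 < e -> e < 1 -> (1 - e) * `|lincomb f theta x| <= (1 + e) * K.
  move=> e0 e1.
  (* A coordinatewise error [del] changes a combination by at most [M * (del * L) <= e * K], which
     exactly fits the room left by shrinking: [(1 - e) * K + e * K = K]. Using [M.+1] avoids a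
     division by zero. *)
  pose del := e * K / (L * M.+1%:R).
  have del0 : 0 < del by rewrite divr_gt0 ?mulr_gt0.
  have /choice[q hq] : forall j, exists q : rat, `|ratr q - (1 - e) * theta 0 j| <= del.
    move=> j; have : (1 - e) * theta 0 j - del < (1 - e) * theta 0 j + del by lra.
    move=> /rat_in_itvoo[q]; rewrite in_itv/= => /andP[q1 q2].
    by exists q; rewrite ler_norml; apply/andP; split; lra.
  pose Q : 'rV[rat]_M := \row_j q j.
  pose D := th Q - (1 - e) *: theta.
  have DE y : lincomb f (th Q) y = (1 - e) * lincomb f theta y + lincomb f D y.
    by rewrite -lincombDZ /D addrC subrK.
  have Db y : (forall j, `|f j y| <= L) -> `|lincomb f D y| <= e * K.
    move=> fy; rewrite (le_trans (norm_lincomb_le (ltW L0) (ltW del0) fy _))//.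
      by move=> j; rewrite !mxE; exact: hq.
    have -> : M%:R * (del * L) = (M%:R / M.+1%:R) * (e * K).
      have m0 : (M.+1%:R : R) != 0 by rewrite pnatr_eq0.
      have L0' : L != 0 by rewrite gt_eqF.
      by rewrite /del; move: (M.+1%:R : R) m0 => m m0; field; rewrite m0 L0'.
    apply: ler_piMl; first by rewrite mulr_ge0 ?(ltW e0) ?(ltW K0).
    by rewrite ler_pdivrMr// mul1r ler_nat.
  have TQ : Theta K X f (th Q).
    apply/Linfty_normP; have aet := (Linfty_normP X _ K).1 Tt.
    apply: filterS2 aef aet => y fy ty; rewrite DE (le_trans (ler_normD _ _))//.
    have := Db y fy; rewrite normrM ger0_norm; last lra.
    have : (1 - e) * `|lincomb f theta y| <= (1 - e) * K by rewrite ler_wpM2l//; lra.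
    lra.
  have := qx Q TQ; have := Db x fx.
  have : (1 - e) * lincomb f theta x = lincomb f (th Q) x - lincomb f D x.
    by rewrite DE; ring.
  move=> /(congr1 Num.norm); rewrite normrM ger0_norm; last lra.
  move=> ->; have := ler_normB (lincomb f (th Q) x) (lincomb f D x); lra.
apply/ler_addgt0Pr => e e0.
move: (`|lincomb f theta x|) (normr_ge0 (lincomb f theta x)) H => a a0 H.
rewrite leNgt; apply/negP => ea.
(* [H] says [a - K <= g * (a + K)], while this [g] makes the right-hand side half of [a - K > 0]. *)
pose g := (a - K) / (2 * (a + K)).
have aK : 0 < a + K by lra.
have g0 : 0 < g by rewrite divr_gt0 ?mulr_gt0//; lra.
have g1 : g < 1 by rewrite ltr_pdivrMr ?mulr_gt0//; lra.
have gE : g * (a + K) = (a - K) / 2 by rewrite /g; field; rewrite gt_eqF.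
have := H g g0 g1; lra.
Qed.

Lemma fine_probability_setT {R : realType} {d : measure_display}
    {T : measurableType d} (P : probability T R) : fine (P setT) = 1.
Proof. by rewrite probability_setT. Qed.

Lemma RintegralDr_cst {R : realType} {d : measure_display}
    {T : measurableType d} (P : probability T R) (g : T -> R) (c : R) :
  P.-integrable setT (EFin \o g) ->
  \int[P]_x (g x + c) = \int[P]_x g x + c.
Proof.
move=> ig; rewrite RintegralD//.
  by rewrite Rintegral_cst// fine_probability_setT mulr1.
by apply: (@bounded_integrable _ _ _ P (fun=> c) `|c|).
Qed.

Lemma EFin_Rintegral {R : realType} {d : measure_display}
    {T : measurableType d} (mu : {measure set T -> \bar R}) (g : T -> R) :
  mu.-integrable setT (EFin \o g) ->
  (\int[mu]_x (g x)%:E)%E = (\int[mu]_x g x)%:E.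
Proof. by move=> ig; rewrite /Rintegral fineK//; exact: integrable_fin_num. Qed.

(** Adding the bounds [b1] and [b2] makes both factors nonnegative; expanding the product rule for
    the shifted factors and cancelling the common terms removes the shift. *)
Lemma independent2_RintegralM {R : realType} {d d1 d2 : measure_display}
    {T : measurableType d} {T1 : measurableType d1} {T2 : measurableType d2}
    (P : probability T R) (U : T -> T1) (V : T -> T2)
    (h1 : T1 -> R) (h2 : T2 -> R) (b1 b2 : R) :
  independent2 P U V -> measurable_fun setT U -> measurable_fun setT V ->
  measurable_fun setT h1 -> measurable_fun setT h2 ->
  (forall z, `|h1 z| <= b1) -> (forall z, `|h2 z| <= b2) ->
  \int[P]_x (h1 (U x) * h2 (V x))
  = (\int[P]_x h1 (U x)) * (\int[P]_x h2 (V x)).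
Proof.
move=> indUV mU mV mh1 mh2 hb1 hb2.
have m1 : measurable_fun setT (h1 \o U) by exact: measurableT_comp.
have m2 : measurable_fun setT (h2 \o V) by exact: measurableT_comp.
have i1 : P.-integrable setT (EFin \o (h1 \o U)).
  by apply: (@bounded_integrable _ _ _ P _ b1) => //= x; exact: hb1.
have i2 : P.-integrable setT (EFin \o (h2 \o V)).
  by apply: (@bounded_integrable _ _ _ P _ b2) => //= x; exact: hb2.
have i12 : P.-integrable setT (EFin \o (fun x => h1 (U x) * h2 (V x))).
  apply: (@bounded_integrable _ _ _ P _ (b1 * b2)); first exact: measurable_funM.
  by move=> x; rewrite normrM ler_pM.
have ic1 : P.-integrable setT (EFin \o (fun x => h1 (U x) + b1)).
  apply: (@bounded_integrable _ _ _ P _ (b1 + `|b1|)); first exact: measurable_funD.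
  by move=> x; rewrite (le_trans (ler_normD _ _))// lerD2r.
have ic2 : P.-integrable setT (EFin \o (fun x => h2 (V x) + b2)).
  apply: (@bounded_integrable _ _ _ P _ (b2 + `|b2|)); first exact: measurable_funD.
  by move=> x; rewrite (le_trans (ler_normD _ _))// lerD2r.
have im1 : P.-integrable setT (EFin \o (fun x => h1 (U x) * b2)).
  apply: (@bounded_integrable _ _ _ P _ (b1 * `|b2|)); first exact: measurable_funM.
  by move=> x; rewrite normrM ler_wpM2r.
have im2 : P.-integrable setT (EFin \o (fun x => h2 (V x) * b1)).
  apply: (@bounded_integrable _ _ _ P _ (b2 * `|b1|)); first exact: measurable_funM.
  by move=> x; rewrite normrM ler_wpM2r.
have im12 : P.-integrable setT (EFin \o (fun x => h1 (U x) * h2 (V x) + h1 (U x) * b2)).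
  by have := integrableD measurableT i12 im1; apply: eq_integrable.
have im21 : P.-integrable setT
    (EFin \o (fun x => h1 (U x) * h2 (V x) + h1 (U x) * b2 + h2 (V x) * b1)).
  by have := integrableD measurableT im12 im2; apply: eq_integrable.
have n1 z : 0 <= h1 z + b1 by have := hb1 z; rewrite ler_norml; lra.
have n2 z : 0 <= h2 z + b2 by have := hb2 z; rewrite ler_norml; lra.
have mb1 : measurable_fun setT (fun z => h1 z + b1) by exact: measurable_funD.
have mb2 : measurable_fun setT (fun z => h2 z + b2) by exact: measurable_funD.
have e1 : (\int[P]_x (h1 (U x) + b1)%:E)%E = (\int[P]_x h1 (U x) + b1)%:E.
  by rewrite (EFin_Rintegral ic1) RintegralDr_cst.
have := independent2_ge0_integralM indUV mU mV mb1 mb2 n1 n2 e1.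
rewrite (EFin_Rintegral ic2) (RintegralDr_cst _ i2).
rewrite (_ : (fun x => ((h1 (U x) + b1) * (h2 (V x) + b2))%:E) =
    (fun x => (h1 (U x) * h2 (V x) + h1 (U x) * b2 + h2 (V x) * b1 + b1 * b2)%:E)); last first.
  by apply/funext => x; congr EFin; ring.
rewrite EFin_Rintegral; last first.
  have ib : P.-integrable setT (EFin \o (fun x : T => b1 * b2)).
    by apply: (@bounded_integrable _ _ _ P (fun=> b1 * b2) `|b1 * b2|).
  by have := integrableD measurableT im21 ib; apply: eq_integrable.
rewrite RintegralDr_cst// RintegralD// RintegralD// !RintegralZr//.
by move=> [] h; nra.
Qed.

(** [clip B] is odd and [W] has the law of [- W], so the mean equals its opposite. The shift by [B]
    reduces to nonnegative integrands. *)
Lemma symmetric_clip_mean {R : realType} {d : measure_display}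
    {T : measurableType d} (P : probability T R) (W : T -> R) (B : R) :
  0 <= B -> symmetric_law P W -> measurable_fun setT W ->
  \int[P]_x clip B (W x) = 0.
Proof.
move=> B0 sW mW.
have mc := measurable_clip B.
have mNW : measurable_fun setT (fun x => - W x) by exact: measurableT_comp.
have mcW : measurable_fun setT (clip B \o W) by exact: measurableT_comp.
have ic : P.-integrable setT (EFin \o (clip B \o W)).
  by apply: (@bounded_integrable _ _ _ P _ B) => // x; exact: norm_clip.
have icN : P.-integrable setT (EFin \o (fun x => - clip B (W x))).
  apply: (@bounded_integrable _ _ _ P _ B); first exact: measurableT_comp.
  by move=> x; rewrite normrN; exact: norm_clip.
have iB (g : T -> R) : P.-integrable setT (EFin \o g) ->
    P.-integrable setT (EFin \o (fun x => g x + B)).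
  move=> ig; have ib : P.-integrable setT (EFin \o (fun x : T => B)).
    by apply: (@bounded_integrable _ _ _ P (fun=> B) `|B|).
  by have := integrableD measurableT ig ib; apply: eq_integrable.
have := @same_law_ge0_integral _ _ _ _ _ P W (fun x => - W x) (fun z => clip B z + B) sW mW mNW.
have mcB : measurable_fun setT (fun z => clip B z + B) by exact: measurable_funD.
have cB z : 0 <= clip B z + B by have := norm_clip z B0; rewrite ler_norml; lra.
move=> /(_ mcB cB).
under [X in _ = X -> _]eq_integral do rewrite clipN//.
rewrite EFin_Rintegral; last exact: (iB _ icN).
rewrite EFin_Rintegral; last exact: (iB _ ic).
rewrite !RintegralDr_cst// => -[].
under [X in _ = X + _ -> _]eq_Rintegral do rewrite -mulN1r.
rewrite RintegralZl//; lra.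
Qed.

Lemma near_kink_probability {R : realType} {d : measure_display}
    {T : measurableType d} (P : probability T R) (W : {RV P >-> R}) (B u : R) :
  0 < u -> 1.-lipschitz (fun t : R => fine (cdf W t)) ->
  fine (P [set w | near_kink B u (W w)]) <= 4 * u.
Proof.
move=> u0 lip.
have itvP a b : a <= b -> measurable [set w | a < W w <= b] /\
    (P [set w | (a < W w <= b)%R] <= (b - a)%:E)%E.
  move=> ab.
  have E : [set w | (a < W w <= b)%R] = W @^-1` `]a, b].
    by apply/seteqP; split => w /=; rewrite in_itv.
  have mI (I : interval R) : measurable (W @^-1` [set` I]).
    by rewrite -[X in measurable X]setTI; exact: measurable_funP.
  rewrite E; split; first exact: mI.
  have EU : W @^-1` `]-oo, b] = W @^-1` `]-oo, a] `|` W @^-1` `]a, b].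
    rewrite -preimage_setU -itv_bndbnd_setU ?bnd_simp//.
  have := lip (b, a); rewrite /= => /(_ (conj I I)).
  rewrite mul1r /cdf /distribution/= /pushforward EU measureU//; last first.
    rewrite -preimage_setI; apply/seteqP; split => // w /= [].
    by rewrite !in_itv/= => wa /andP[]; lra.
  have f1 := fin_num_measure P _ (mI `]-oo, a]).
  have f2 := fin_num_measure P _ (mI `]a, b]).
  rewrite fineD// addrAC subrr add0r ger0_norm ?fine_ge0// ger0_norm; last lra.
  by move=> h; rewrite -(fineK f2) lee_fin.
have [m1 p1] := itvP (B - u) (B + u) ltac:(lra).
have [m2 p2] := itvP (- B - u) (- B + u) ltac:(lra).
have -> : [set w | near_kink B u (W w)] =
    [set w | (B - u < W w <= B + u)%R] `|` [set w | (- B - u < W w <= - B + u)%R].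
  by apply/seteqP; split => w /= /orP.
have := measureU2 P m1 m2; move=> /le_trans /(_ (leeD p1 p2)).
rewrite -EFinD -[X in (X <= _)%E]fineK ?lee_fin; last first.
  by apply: fin_num_measure; exact: measurableU.
by move=> h; apply: (le_trans h); lra.
Qed.

(** * Norms, indicators and numerical constants *)

Lemma rV_norm_leP {R : realType} {M : nat} (v : 'rV[R]_M) (r : R) : 0 <= r ->
  reflect (forall j, `|v 0 j| <= r) (`|v| <= r).
Proof.
move=> r0; apply: (iffP idP) => [vr j|vr].
  apply: le_trans vr; rewrite [leRHS]/Num.norm/= mx_normrE.
  by apply/bigmax_geP; right => /=; exists (0, j).
rewrite [leLHS]/Num.norm/= mx_normrE; apply: bigmax_le => // -[i j] _ /=.
by rewrite ord1.
Qed.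

Lemma natr_bool_indic {R : realType} {T : Type} (b : T -> bool) (x : T) :
  (b x)%:R = \1_[set x | b x] x :> R.
Proof. by rewrite indicE; congr (_ %:R); congr nat_of_bool; apply/idP/idP; rewrite inE. Qed.

Lemma measurable_natr_bool {R : realType} {d : measure_display}
    {T : measurableType d} (b : T -> bool) :
  measurable [set x | b x] -> measurable_fun setT (fun x => (b x)%:R : R).
Proof.
move=> mb; rewrite (_ : (fun x => _) = \1_[set x | b x]).
  exact: measurable_indic.
by apply/funext => x; exact: natr_bool_indic.
Qed.

Lemma Rintegral_natr_bool {R : realType} {d : measure_display}
    {T : measurableType d} (P : probability T R) (b : T -> bool) :
  measurable [set x | b x] -> \int[P]_x (b x)%:R = fine (P [set x | b x]).
Proof.
move=> mb; rewrite /Rintegral -[in RHS]integral_indicT//; congr fine.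
by apply: eq_integral => x _; rewrite -natr_bool_indic.
Qed.

Lemma Rintegral_sqr_le1 {R : realType} {d : measure_display}
    {T : measurableType d} (P : probability T R) (g : T -> R) :
  measurable_fun setT g -> (forall x, `|g x| <= 1) ->
  \int[P]_x g x ^+ 2 <= 1.
Proof.
move=> mg g1; have <- : \int[P]_(x in setT) (1 : R) = 1.
  by rewrite Rintegral_cst// fine_probability_setT mulr1.
apply: le_Rintegral => //.
- apply: (@bounded_integrable _ _ _ P _ 1); first exact: measurable_funX.
  by move=> x; rewrite normrX exprn_ile1.
- by apply: (@bounded_integrable _ _ _ P (fun=> 1) 1) => // x; rewrite normr1.
- by move=> x _; rewrite -[_ ^+ 2]ger0_norm ?sqr_ge0// normrX exprn_ile1.
Qed.

(* As [6 * rtilde >= 24 * sqrt (ln M / n)], the right-hand side is at least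
   [(23 / 2) * ln M]. *)
Lemma deviation_exponent {R : realType} (L : R) (M n : nat) (l := Num.sqrt (ln M%:R / n%:R) / 2) :
  (2 <= M)%N -> (0 < n)%N -> 0 <= L ->
  11 * ln M%:R <= n%:R * (l * (6 * rtilde L M n - 2 * l)).
Proof.
move=> M2 n0 L0; have lM : 0 < ln M%:R :> R by rewrite ln_gt0// ltr1n.
have n0' : 0 < n%:R :> R by rewrite ltr0n.
have x0 : 0 < ln M%:R / n%:R :> R by rewrite divr_gt0.
have le : n%:R * Num.sqrt (ln M%:R / n%:R) ^+ 2 = ln M%:R :> R.
  by rewrite sqr_sqrtr ?(ltW x0)//; field; rewrite gt_eqF.
have s6 : 2 <= Num.sqrt 6 :> R.
  have -> : 2 = Num.sqrt (2 ^+ 2) :> R by rewrite sqrtr_sqr ger0_norm.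
  by rewrite ler_sqrt// expr2; lra.
rewrite /rtilde -/l.
have h0 : 0 <= 4 * Num.sqrt 2 * L * (ln M%:R / n%:R).
  by rewrite mulr_ge0 ?(ltW x0)// !mulr_ge0 ?sqrtr_ge0.
have q0 := sqrtr_ge0 (ln M%:R / n%:R : R).
rewrite -[in leLHS]le /l; set q := Num.sqrt (ln M%:R / n%:R) in q0 *.
have h1 : 4 * q <= 2 * Num.sqrt 6 * q by rewrite ler_wpM2r//; lra.
have -> : 11 * (n%:R * q ^+ 2) = n%:R * (q / 2 * (22 * q)) by field.
rewrite ler_wpM2l// ler_wpM2l ?divr_ge0//. lra.
Qed.

(** The count is that of the controlled averages: [M] scores, two truncated Gram matrices, one kink
    indicator; the leading 2 is for the signs. As [M >= 2], twice the count is at most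
    [M ^ 2 * 2 ^ 8 <= M ^ 10], which [M ^- 11] absorbs. *)
Lemma union_tail {R : realType} (M : nat) (x : R) : (2 <= M)%N -> 11 * ln M%:R <= x ->
  2 * (M + M * M * 2 + 1)%:R * expR (- x) <= M%:R^-1 :> R.
Proof.
move=> M2 hx; have M0 : 0 < M%:R :> R by rewrite ltr0n (leq_trans _ M2).
apply: (@le_trans _ _ (2 * (M + M * M * 2 + 1)%:R * M%:R ^- 11)).
  rewrite ler_wpM2l ?mulr_ge0//.
  rewrite (_ : M%:R ^- 11 = expR (- (11 * ln M%:R))); first by rewrite ler_expR lerN2.
  by rewrite expRN expRM_natl lnK// posrE.
rewrite -[leRHS](mulfK (_ : M%:R ^+ 11 != 0)) ?expf_neq0 ?gt_eqF//.
rewrite ler_wpM2r ?invr_ge0 ?exprn_ge0 ?(ltW M0)//.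
have M2' : 2 <= M%:R :> R by rewrite ler_nat.
rewrite exprS mulKf ?gt_eqF// -natrX -(natrM _ 2) ler_nat.
have e2 : (M ^ 10 = M ^ 2 * M ^ 8)%N by rewrite -expnD.
have e3 : (2 ^ 8 <= M ^ 8)%N by rewrite leq_exp2r.
rewrite e2; apply: (@leq_trans (M ^ 2 * 2 ^ 8)); last by rewrite leq_mul2l e3 orbT.
rewrite -mulnn; have : (2 * 2 <= M * M)%N by exact: leq_mul.
have : (M <= M * M)%N by rewrite leq_pmulr// (leq_trans _ M2).
move: (M * M)%N => m; lia.
Qed.

(** [gam = p - p / beta] is the curvature that survives coherence. The 24 is the value at [K = 1] of
    the term [8 * (1 + 2 * K)] in [C1 * gam]. *)
Lemma C1_gap {R : realType} (K beta p : R) : 1 <= K -> 1 < beta -> 0 < p ->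
  let gam := p * (beta - 1) / beta in 0 < gam /\ 24 <= C1 K beta p * gam.
Proof.
move=> K1 b1 p0 gam; have b0 : 0 < beta by lra.
have b10 : 0 < beta - 1 by lra.
have g0 : 0 < gam by rewrite !divr_gt0 ?mulr_gt0.
split => //; rewrite /C1.
have -> : (8 * (1 + 2 * K) * beta / (p * (beta - 1)) + 1 / 6) * gam
    = 8 * (1 + 2 * K) + gam / 6.
  by rewrite /gam; field; rewrite !gt_eqF.
lra.
Qed.

(** * The deviation event *)

Lemma measurable_lincomb {R : realType} {d M : nat}
    (f : 'I_M -> {mfun d.-tuple R >-> R}) (theta : 'rV[R]_M) :
  measurable_fun setT (lincomb f theta).
Proof.
apply: (@measurable_sum _ _ _ _ _ _ (fun j x => theta 0 j * f j x)) => j.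
exact: measurable_funM.
Qed.

(** All randomness is confined here: on [A] the rest of the proof is deterministic. The level
    [a = alpha] serves the l1 bound and [a = B] the sup-norm bound. *)
Lemma deviation_event
  {R : realType} {dT : measure_display} {T : measurableType dT}
  (P : probability T R) (d M n : nat)
  (f : 'I_M -> {mfun d.-tuple R >-> R}) (theta_star : 'rV[R]_M)
  (X : {RV P >-> d.-tuple R}) (W Y : {RV P >-> R})
  (Xs : 'I_n -> {RV P >-> d.-tuple R}) (Ys : 'I_n -> {RV P >-> R})
  (alpha B L u : R) (G : set (d.-tuple R)) :
  (forall w, Y w = lincomb f theta_star (X w) + W w) ->
  independent2 P X W -> symmetric_law P W ->
  iid_copies P (fun w => (X w, Y w)) (fun i w => (Xs i w, Ys i w)) ->
  (2 <= M)%N -> (0 < n)%N -> 0 < B -> 1 <= L ->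
  L * Num.sqrt (ln M%:R / n%:R) <= 1 ->
  measurable G -> P (X @^-1` (~` G)) = 0%E ->
  (forall x j, G x -> `|f j x| <= L) ->
  (forall j, gram X f j j = 1) ->
  0 < u -> 1.-lipschitz (fun t : R => fine (cdf W t)) ->
  let noise i w := Ys i w - lincomb f theta_star (Xs i w) in
  exists A : set T, [/\ measurable A, ((1 - M%:R^-1)%:E <= P A)%E
    & forall w, A w ->
    [/\ forall i, G (Xs i w),
        forall j, `|n%:R^-1 * \sum_(i < n) clip B (noise i w) * f j (Xs i w)|
                  <= 6 * B * rtilde L M n,
        forall a, a = alpha \/ a = B -> forall j k,
          `|n%:R^-1 * (\sum_(i < n) (`|noise i w| <= a)%R%:R * (f j (Xs i w) * f k (Xs i w)))
            - prob_abs_le P W a * gram X f j k| <= 6 * L ^+ 2 * rtilde L M n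
      & n%:R^-1 * (\sum_(i < n) (near_kink B u (noise i w))%:R)
        <= 4 * u + 6 * rtilde L M n]].
Proof.
move=> hY hXW hWsym hiid hM n0 B0 L1 hl mG PG fG gram1 u0 lip noise.
have L0 : 0 < L by lra.
have L20 : 0 < L ^+ 2 by exact: exprn_gt0.
have n0' : 0 < n%:R :> R by rewrite ltr0n.
have mX : measurable_fun setT X by exact: measurable_funP.
have mW : measurable_fun setT W by exact: measurable_funP.
have mZ0 : measurable_fun setT (fun w => (X w, Y w)).
  by apply/measurable_fun_pair => //; exact: measurable_funP.
have mZ i : measurable_fun setT (fun w => (Xs i w, Ys i w)).
  by apply/measurable_fun_pair => //; exact: measurable_funP.
(* Truncating the dictionary to [G] makes it bounded everywhere. *)
pose ft j x := f j x * \1_G x.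
have mft j : measurable_fun setT (ft j).
  by apply: measurable_funM => //; exact: measurable_indic.
have ftL j x : `|ft j x| <= L.
  rewrite /ft indicE; have [|_] := boolP (x \in G).
    by rewrite inE mulr1; exact: fG.
  by rewrite mulr0 normr0 ltW.
have mftX j : measurable_fun setT (ft j \o X) by exact: measurableT_comp.
have gramE j k : \int[P]_w (ft j (X w) * ft k (X w)) = gram X f j k.
  rewrite mxE /Rintegral unlock; congr fine; apply: ae_eq_integral => //.
  - apply/measurable_EFinP; apply: measurable_funM; exact: mftX.
  - apply/measurable_EFinP; apply: measurable_funM; exact: measurableT_comp.
  - exists (X @^-1` (~` G)); split => //.
      by rewrite -[X in measurable X]setTI; apply: mX => //; exact: measurableC.
    move=> w /=; apply: contra_not => Gw _.
    by rewrite /ft indicE mem_set ?mulr1//; exact: contrapT.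
(* [res] recovers the noise from the pair, so that each average below is over a fixed function of
   the i.i.d. pairs. *)
pose res (z : d.-tuple R * R) := z.2 - lincomb f theta_star z.1.
have mres : measurable_fun setT res.
  apply: measurable_funB => //.
  exact: (measurableT_comp (measurable_lincomb f theta_star) (@measurable_fst _ _ _ _)).
have resE w : res (X w, Y w) = W w by rewrite /res /= hY addrAC subrr add0r.
pose rad (c : bool) := if c then alpha else B.
have mabs a : measurable [set w : R | `|w| <= a].
  by rewrite -[X in measurable X]setTI; apply: measurable_fun_le => //.
have mkink : measurable [set w : R | near_kink B u w].
  rewrite (_ : [set w | _] = `](B - u), (B + u)] `|` `](- B - u), (- B + u)]).
    by apply: measurableU.
  by apply/seteqP; split => w /=; rewrite !in_itv => /orP.
(* Division by [B] and [L ^+ 2] normalizes the second moments to at most 1, with [L] as common sup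
   bound. *)
pose g (p : 'I_M + 'I_M * 'I_M * bool + unit) (z : d.-tuple R * R) : R :=
  match p with
  | inl (inl j) => clip B (res z) / B * ft j z.1
  | inl (inr (j, k, c)) => (`|res z| <= rad c)%R%:R * (ft j z.1 * ft k z.1 / L ^+ 2)
  | inr _ => (near_kink B u (res z))%:R
  end.
have mft1 j : measurable_fun setT (fun z : d.-tuple R * R => ft j z.1).
  exact: (measurableT_comp (mft j) (@measurable_fst _ _ _ _)).
have mclip : measurable_fun setT (fun w => clip B w / B).
  by apply: measurable_funM => //; exact: measurable_clip.
have mabsf a : measurable_fun setT (fun w : R => (`|w| <= a)%R%:R : R).
  exact: measurable_natr_bool.
have mkinkf : measurable_fun setT (fun w : R => (near_kink B u w)%:R : R).
  exact: measurable_natr_bool.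
have mg p : measurable_fun setT (g p).
  case: p => [[j|[[j k] c]]|[]] /=.
  - by apply: measurable_funM => //; exact: (measurableT_comp mclip mres).
  - apply: measurable_funM; first exact: (measurableT_comp (mabsf _) mres).
    by apply: measurable_funM => //; exact: measurable_funM.
  - exact: (measurableT_comp mkinkf mres).
have clip1 w : `|clip B w / B| <= 1.
  by rewrite normrM normfV [`|B|]ger0_norm ?(ltW B0)// ler_pdivrMr// mul1r norm_clip ?ltW.
have bool1 (b : bool) : `|b%:R : R| <= 1 by rewrite normr_nat lern1; case: b.
have ftft1 j k x : `|ft j x * ft k x / L ^+ 2| <= 1.
  rewrite normrM normfV [`|L ^+ 2|]ger0_norm ?(ltW L20)// ler_pdivrMr// mul1r.
  by rewrite normrM expr2 ler_pM.
have gram_abs1 j k c z : `|g (inl (inr (j, k, c))) z| <= 1.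
  by rewrite /= normrM mulr_ile1.
have gb p z : `|g p z| <= L.
  case: p => [[j|[[j k] c]]|[]] /=.
  - by rewrite normrM -[leRHS]mul1r ler_pM.
  - exact: (le_trans (gram_abs1 j k c z) L1).
  - exact: le_trans (bool1 _) L1.
have mgZ0 p : measurable_fun setT (fun w => g p (X w, Y w)).
  exact: (measurableT_comp (mg p) mZ0).
have g2 p : \int[P]_w g p (X w, Y w) ^+ 2 <= 1.
  case: p => [[j|[[j k] c]]|[]].
  (* The clipped factor is at most 1, so the unit diagonal of the Gram matrix bounds the score's
     second moment, although its sup bound is [L]. *)
  - rewrite -(gram1 j) -gramE; apply: le_Rintegral => //.
    + apply: (@bounded_integrable _ _ _ P _ (L ^+ 2)).
        by apply: measurable_funX; exact: mgZ0.
      by move=> w; rewrite normrX lerXn2r ?nnegrE// ltW.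
    + apply: (@bounded_integrable _ _ _ P _ (L * L)).
        by apply: measurable_funM; exact: mftX.
      by move=> w; rewrite normrM ler_pM.
    + move=> w _ /=; rewrite -expr2 exprMn ler_piMl ?sqr_ge0//.
      by rewrite -[leLHS]ger0_norm ?sqr_ge0// normrX exprn_ile1.
  - by apply: Rintegral_sqr_le1 => // w; exact: gram_abs1.
  - by apply: Rintegral_sqr_le1 => // w; exact: bool1.
(* This [l] satisfies [l * L <= 1 / 2] because [L * sqrt (ln M / n) <= 1], and it is the one for
   which the exponent is at least [11 * ln M]. *)
pose l : R := Num.sqrt (ln M%:R / n%:R) / 2.
have l0 : 0 < l.
  by rewrite divr_gt0// sqrtr_gt0 divr_gt0// ln_gt0// ltr1n.
have lL : l * L <= 2^-1 by rewrite /l; lra.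
have [A [mA PA HA]] := iid_uniform_deviation (6 * rtilde L M n) hiid mZ0 mZ mg gb g2 l0 lL.
have mXs i : measurable (Xs i @^-1` (~` G)).
  by rewrite -[X in measurable X]setTI; apply: measurable_funP => //; exact: measurableC.
(* Sample points leaving [G] form a null event, since each [Xs i] has the law of [X]. *)
pose N := \bigcup_(i : 'I_n) Xs i @^-1` (~` G).
have [mN N0] : measurable N /\ (P N <= (#|'I_n|%:R * 0 : R)%:E)%E.
  apply: finite_union_bound => // i.
  have := hiid.2 i ((~` G) `*` setT) (measurableX (measurableC mG) measurableT).
  rewrite (_ : (fun w => (Xs i w, Ys i w)) @^-1` _ = Xs i @^-1` (~` G)); last first.
    by apply/seteqP; split => w //= [].
  rewrite (_ : (fun w => (X w, Y w)) @^-1` _ = X @^-1` (~` G)); last first.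
    by apply/seteqP; split => w //= [].
  by move=> E; rewrite measure_le0; apply/eqP; exact: (etrans E PG).
rewrite mulr0 in N0.
have mean_clip j : \int[P]_w g (inl (inl j)) (X w, Y w) = 0.
  rewrite /g; under eq_Rintegral do rewrite resE /= mulrC.
  rewrite (independent2_RintegralM (h1 := ft j) (h2 := fun w => clip B w / B)
    hXW mX mW (mft j) mclip (ftL j) clip1).
  rewrite RintegralZr//; last first.
    apply: (@bounded_integrable _ _ _ P _ B).
      exact: (measurableT_comp (measurable_clip B) mW).
    by move=> w; rewrite norm_clip// ltW.
  by rewrite symmetric_clip_mean ?mul0r ?mulr0// ltW.
have mean_gram j k c : \int[P]_w g (inl (inr (j, k, c))) (X w, Y w)
    = prob_abs_le P W (rad c) * (gram X f j k / L ^+ 2).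
  rewrite /g; under eq_Rintegral do rewrite resE /= mulrC.
  rewrite (independent2_RintegralM (h1 := fun x : d.-tuple R => ft j x * ft k x / L ^+ 2)
    (h2 := fun w : R => (`|w| <= rad c)%R%:R) (b1 := 1) (b2 := 1) hXW mX mW)//; last first.
    by apply: measurable_funM => //; exact: measurable_funM.
  rewrite Rintegral_natr_bool; last first.
    by rewrite -[X in measurable X]setTI; exact: (mW measurableT _ (mabs (rad c))).
  rewrite RintegralZr//; last first.
    apply: (@bounded_integrable _ _ _ P _ (L * L)).
      by apply: measurable_funM; exact: mftX.
    by move=> w; rewrite normrM ler_pM.
  by rewrite gramE mulrC.
have mean_kink : \int[P]_w g (inr tt) (X w, Y w) <= 4 * u.
  rewrite /g; under eq_Rintegral do rewrite resE.
  rewrite Rintegral_natr_bool; last first.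
    by rewrite -[X in measurable X]setTI; exact: (mW measurableT _ mkink).
  exact: near_kink_probability.
exists (A `\` N); split; first exact: measurableD.
  have -> : P (A `\` N) = P A.
    rewrite measureD//; last by rewrite (le_lt_trans (probability_le1 _ _)) ?ltry.
    rewrite [X in (_ - X)%E](_ : _ = 0%E) ?sube0//.
    apply/eqP; rewrite -measure_le0 (le_trans _ N0)// le_measure ?inE//.
    exact: measurableI.
  apply: le_trans PA; rewrite lee_fin lerD2l lerN2.
  rewrite !card_sum !card_prod !card_ord card_bool card_unit.
  by apply: union_tail => //; apply: deviation_exponent => //; exact: ltW.
move=> w [Aw Nw].
have Gw i : G (Xs i w) by apply: contrapT => h; apply: Nw; exists i.
have ftE i j : ft j (Xs i w) = f j (Xs i w) by rewrite /ft indicE mem_set ?mulr1.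
have dev p : `|n%:R^-1 * (\sum_(i < n) g p (Xs i w, Ys i w)) - \int[P]_x g p (X x, Y x)|
    <= 6 * rtilde L M n.
  rewrite -(ler_pM2l n0'); apply: le_trans (HA w Aw p).
  rewrite -[X in X * _]ger0_norm// -normrM mulrBr mulrA divff ?mul1r// gt_eqF//.
split => //.
- move=> j; have := dev (inl (inl j)); rewrite mean_clip subr0 /g /=.
  under eq_bigr do rewrite ftE.
  rewrite [X in `|_ * X|](_ : _ = B^-1 *
    \sum_(i < n) clip B (noise i w) * f j (Xs i w)); last first.
    by rewrite mulr_sumr; apply: eq_bigr => i _; rewrite mulrAC mulrC.
  rewrite mulrCA normrM normfV [`|B|]ger0_norm ?(ltW B0)// ler_pdivrMl//.
  by rewrite mulrCA mulrA.
- move=> a ha j k.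
  have [c ->] : exists c, a = rad c.
    by case: ha => ->; [exists true|exists false].
  have := dev (inl (inr (j, k, c))); rewrite mean_gram /g /=.
  under eq_bigr do rewrite !ftE.
  rewrite [X in `|_ * X - _|](_ : _ = (L ^+ 2)^-1 *
    \sum_(i < n) (`|noise i w| <= rad c)%R%:R * (f j (Xs i w) * f k (Xs i w))); last first.
    by rewrite mulr_sumr; apply: eq_bigr => i _; rewrite [RHS]mulrC [LHS]mulrA.
  rewrite mulrCA [_ * (gram _ _ _ _ / _)]mulrA [_ / L ^+ 2]mulrC -mulrBr.
  rewrite normrM normfV [`|L ^+ 2|]ger0_norm ?(ltW L20)// ler_pdivrMl//.
  by rewrite mulrCA mulrA.
- have := dev (inr tt); rewrite ler_norml /g /= => /andP[_]; rewrite lerBlDl => /le_trans; apply.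
  rewrite lerD2r; exact: mean_kink.
Qed.

(** * The sup-norm bound *)

(** [ts] vanishes off [J], so minimality bounds the l1 mass of [th] off [J] by what [th] loses on
    [J], and the triangle inequality bounds that loss by the error on [J]. *)
Lemma l1_minimal_cone {R : realType} {M : nat} (th ts : 'rV[R]_M)
    (J := [set j : 'I_M | ts 0 j != 0]%SET) :
  l1norm th <= l1norm ts ->
  \sum_(j in ~: J) `|th 0 j - ts 0 j| <= \sum_(j in J) `|th 0 j - ts 0 j|.
Proof.
have splitJ (g : 'I_M -> R) : \sum_(j < M) g j = \sum_(j in J) g j + \sum_(j in ~: J) g j.
  by rewrite (bigID (mem J))/=; congr (_ + _); apply: eq_bigl => j; rewrite finset.in_setC.
rewrite /l1norm (splitJ (fun j => `|th 0 j|)) (splitJ (fun j => `|ts 0 j|)).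
have ts0 j : j \in ~: J -> ts 0 j = 0 by rewrite !inE negbK => /eqP.
rewrite [X in _ <= _ + X]big1; last by move=> j /ts0 ->; rewrite normr0.
rewrite addr0 => h.
rewrite (eq_bigr (fun j => `|th 0 j|)); last by move=> j /ts0 ->; rewrite subr0.
have : \sum_(j in J) `|ts 0 j| <= \sum_(j in J) (`|th 0 j| + `|th 0 j - ts 0 j|).
  apply: ler_sum => j _.
  by have := ler_normB (th 0 j) (th 0 j - ts 0 j); rewrite subKr.
rewrite big_split/=; lra.
Qed.

(** The coherence part of the error contributes exactly [p / beta = p - gam]. The sampling part
    [18 * L ^+ 2 * rt * s] is at most a multiple of [L ^+ 3 * r * s], which the last two hypotheses
    force below a small fraction of [gam]. *)
Lemma restricted_coherence {R : realType} (p beta L rt r s c gam : R) :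
  gam = p * (beta - 1) / beta -> 1 < beta -> 0 < gam -> 1 <= L -> 0 <= rt ->
  0 < s -> 12 * rt <= r -> 24 <= c * gam -> 12 * L ^+ 3 * (c * r * s) <= 2^-1 ->
  gam / 2 + 3 * (6 * L ^+ 2 * rt + p / (3 * beta * s)) * s <= p.
Proof.
move=> gE b1 g0 L1 rt0 s0 rtr cg h8.
have b0 : beta != 0 by rewrite gt_eqF//; lra.
have s0' : s != 0 by rewrite gt_eqF.
have -> : 3 * (6 * L ^+ 2 * rt + p / (3 * beta * s)) * s
    = 18 * L ^+ 2 * rt * s + p / beta by field; rewrite b0 s0'.
have gE' : gam = p - p / beta by rewrite gE; field.
have L30 : 0 <= L ^+ 3 by rewrite exprn_ge0//; lra.
have r0 : 0 <= r by lra.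
have m0 : 0 <= L ^+ 3 * (r * s) by rewrite mulr_ge0// mulr_ge0// ltW.
have h1 : 24 * (L ^+ 3 * (r * s)) <= c * gam * (L ^+ 3 * (r * s)) by rewrite ler_wpM2r.
have h2 : 12 * L ^+ 3 * (c * r * s) * gam <= 2^-1 * gam by rewrite ler_wpM2r// ltW.
have h3 : L ^+ 2 <= L ^+ 3 by rewrite [leRHS]exprS ler_peMl ?sqr_ge0.
have h4 : L ^+ 2 * (12 * rt * s) <= L ^+ 3 * (r * s).
  have s0w := ltW s0.
  apply: ler_pM => //; first exact: sqr_ge0.
    by rewrite !mulr_ge0.
  by rewrite ler_wpM2r.
nra.
Qed.

(** Each error term is brought to order [r]: [s ^+ 2 * r <= 1] gives [e ^+ 2 <= c ^+ 2 * r],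
    smallness of [L ^+ 3 * e] absorbs the products of [rt] and [e], and the factor [1 / s] of the
    coherence cancels the [s] in [e]. The slack [x] stands for the last summand of [C3]. *)
Lemma sup_error_arith {R : realType} (q beta L rt r s c e x D1 D : R) :
  e = c * r * s -> 0 < q <= 1 -> 1 < beta -> 1 <= L -> 0 <= rt -> 0 < s ->
  12 * rt <= r -> 0 <= c -> 12 * L ^+ 3 * e <= 2^-1 -> s ^+ 2 * r <= 1 ->
  0 <= x -> 0 <= D1 <= e ->
  q * D <= 2 * r + L ^+ 2 * D1 * (4 * (L * e) + 6 * rt) + 6 * L ^+ 2 * rt * D1
           + q * (1 / (3 * beta * s)) * D1 ->
  D <= (4 + 2 * c * (1 / (3 * beta) + 12 * L ^+ 3 * c + x)) / q * r.
Proof.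
move=> eE /andP[q0 q1] b1 L1 rt0 s0 rtr c0 h8 h7 x0 /andP[D10 D1e] H.
have b0 : 0 < beta by lra.
have r0 : 0 <= r by lra.
have e0 : 0 <= e by lra.
have L20 : 0 <= L ^+ 2 by exact: sqr_ge0.
have L30 : 0 <= L ^+ 3 by rewrite exprn_ge0//; lra.
have w0 : 0 <= 1 / (3 * beta * s) by rewrite divr_ge0// !mulr_ge0// ltW.
have Le0 : 0 <= L * e by rewrite mulr_ge0//; lra.
rewrite mulrAC ler_pdivlMr// mulrC.
have a1 : L ^+ 2 * D1 * (4 * (L * e) + 6 * rt) <= L ^+ 2 * e * (4 * (L * e) + 6 * rt).
  by rewrite ler_wpM2r//; [lra|rewrite ler_wpM2l].
have a2 : 6 * L ^+ 2 * rt * D1 <= 6 * L ^+ 2 * rt * e.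
  by rewrite ler_wpM2l// mulr_ge0// mulr_ge0.
have a3 : q * (1 / (3 * beta * s)) * D1 <= c * r * (1 / (3 * beta)).
  apply: (@le_trans _ _ (1 * (1 / (3 * beta * s)) * e)).
    apply: ler_pM => //; first by rewrite mulr_ge0// ltW.
    by rewrite ler_wpM2r.
  by rewrite eE le_eqVlt; apply/orP; left; apply/eqP; field; rewrite !gt_eqF.
have a4 : L ^+ 2 * (12 * rt) * e <= r.
  have : L ^+ 2 * (12 * rt) * e <= L ^+ 3 * r * e.
    rewrite ler_wpM2r//; apply: ler_pM => //; first by rewrite mulr_ge0.
    by rewrite [leRHS]exprS ler_peMl.
  have : 12 * L ^+ 3 * e * r <= 2^-1 * r by rewrite ler_wpM2r.
  lra.
have a5 : L ^+ 3 * e ^+ 2 <= L ^+ 3 * c ^+ 2 * r.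
  have -> : L ^+ 3 * e ^+ 2 = L ^+ 3 * c ^+ 2 * r * (s ^+ 2 * r) by rewrite eE; ring.
  by rewrite ler_piMr// mulr_ge0// mulr_ge0// sqr_ge0.
have a6 : 0 <= c * x * r by rewrite !mulr_ge0.
have a7 : 0 <= L ^+ 3 * c ^+ 2 * r by rewrite mulr_ge0// mulr_ge0// sqr_ge0.
have a8 : 0 <= c * r * (1 / (3 * beta)).
  by rewrite !mulr_ge0// invr_ge0 mulr_ge0// ltW.
apply: (le_trans H).
move: a3 a8; set y := 1 / (3 * beta); move=> a3 a8.
have -> : (4 + 2 * c * (y + 12 * L ^+ 3 * c + x)) * r
  = 4 * r + 2 * (c * r * y) + 24 * (L ^+ 3 * c ^+ 2 * r) + 2 * (c * x * r) by ring.
have a9 : L ^+ 2 * e * (4 * (L * e) + 6 * rt) + 6 * L ^+ 2 * rt * e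
   = 4 * (L ^+ 3 * e ^+ 2) + L ^+ 2 * (12 * rt) * e by ring.
lra.
Qed.

Theorem theorem2
  (R : realType) (dT : measure_display) (T : measurableType dT)
  (P : probability T R)
  (d M n s : nat)
  (f : 'I_M -> {mfun d.-tuple R >-> R})
  (theta_star : 'rV[R]_M)
  (X : {RV P >-> d.-tuple R}) (W Y : {RV P >-> R})
  (Xs : 'I_n -> {RV P >-> d.-tuple R}) (Ys : 'I_n -> {RV P >-> R})
  (K alpha L beta c kappa : R)
  (hY : forall w, Y w = lincomb f theta_star (X w) + W w)
  (hXW : independent2 P X W)
  (hWsym : symmetric_law P W)
  (hiid : iid_copies P (fun w => (X w, Y w)) (fun i w => (Xs i w, Ys i w)))
  (hM : (2 <= M)%N)
  (hf2 : forall j, L2_norm X (f j) = 1%E)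
  (hfL : forall j, (Linfty_norm X (f j) <= L%:E)%E)
  (hK : 0 < K) (halpha : 0 < alpha)
  (hrt : rtilde L M n <= 1)
  (hWalpha : 0 < prob_abs_le P W alpha)
  (hs : (1 <= s)%N)
  (h2 : (Linfty_norm X (lincomb f theta_star) <= K%:E)%E)
  (hc : 0 < c) (hkappa : 1 < kappa <= 2)
  (h3 : forall theta, Theta K X f theta ->
     (L2_norm X (fun x => lincomb f theta x - lincomb f theta_star x)%R
      <= (c * (excess_risk K alpha P f X Y theta_star theta) `^ (1 / kappa))%R%:E)%E)
  (h4K : 1 <= K <= Num.sqrt (n%:R / ln M%:R))
  (h4L : 1 <= L <= Num.sqrt (n%:R / ln M%:R))
  (hbeta : 1 < beta)
  (h5d : forall j, gram X f j j = 1)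
  (h5o : forall j k, j != k -> `|gram X f j k| <= 1 / (3 * beta * s%:R))
  (h6 : 1.-lipschitz (fun t : R => fine (cdf W t)))
  (h7 : s%:R <= 1 / Num.sqrt (rate K alpha L M n))
  (h8 : 12 * L ^+ 3 *
          eta K alpha L beta (prob_abs_le P W alpha) M n s
        + L * rtilde L M n
        + C2 K L beta (prob_abs_le P W alpha) s / (Num.sqrt n%:R * s%:R ^+ 2)
        <= prob_abs_le P W (2 * K + alpha) / 2)
  (hsparse : (sparsity theta_star <= s)%N) :
  exists A : set T,
    [/\ measurable A,
        ((1 - M%:R^-1 - M%:R `^ (- K) - expR (- Num.sqrt (ln M%:R))
          - 3 * M%:R `^ (- (2 * K)) * ln (n%:R / ln M%:R))%:E <= P A)%E
      & forall w, A w ->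
          forall theta_hat,
            dantzig_solutions K alpha (rate K alpha L M n) X f Xs Ys w theta_hat ->
            `|theta_hat - theta_star|
            <= C4 K L beta (prob_abs_le P W alpha)
                 (prob_abs_le P W (2 * K + alpha)) s n
               * rate K alpha L M n].
Proof.
set p := prob_abs_le P W alpha in hWalpha h8 *.
set q := prob_abs_le P W (2 * K + alpha) in h8 *.
set r := rate K alpha L M n in h7 h8 *.
set rt := rtilde L M n in hrt h8 *.
case/andP: h4K => K1 _; case/andP: h4L => L1 Ln.
have M0 : 0 < M%:R :> R by rewrite ltr0n (leq_trans _ hM).
have lM : 0 < ln M%:R :> R by rewrite ln_gt0// ltr1n.
have nM1 : 1 <= Num.sqrt (n%:R / ln M%:R) :> R by exact: le_trans Ln.
have n0 : (0 < n)%N.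
  rewrite lt0n; apply/eqP => n0; move: nM1; rewrite n0 mul0r sqrtr0; lra.
have n0' : 0 < n%:R :> R by rewrite ltr0n.
have ell : Num.sqrt (n%:R / ln M%:R) * Num.sqrt (ln M%:R / n%:R) = 1 :> R.
  rewrite -sqrtrM ?divr_ge0 ?(ltW n0') ?(ltW lM)//.
  by rewrite (_ : _ * _ = 1) ?sqrtr1//; field; rewrite !gt_eqF.
have hl : L * Num.sqrt (ln M%:R / n%:R) <= 1
  by apply: (le_trans (ler_wpM2r (sqrtr_ge0 _) Ln)); rewrite ell.
have L0 : 0 < L by lra.
set B := 2 * K + alpha; have B2 : 2 < B by rewrite /B; lra.
have B0 : 0 < B by lra.
have rt0 : 0 < rt.
  have x0 : 0 < ln M%:R / n%:R :> R by rewrite divr_gt0.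
  rewrite /rt /rtilde ltr_wpDl ?mulr_gt0 ?sqrtr_gt0//.
  by rewrite mulr_ge0 ?(ltW x0)// mulr_ge0 ?(ltW L0)// mulr_ge0.
have rE : r = 6 * B * rt by [].
have r0 : 0 < r by rewrite rE !mulr_gt0.
have rtr : 12 * rt <= r by rewrite rE ler_wpM2r ?(ltW rt0)//; lra.
have mprob a : measurable [set w | `|W w| <= a].
  rewrite -[X in measurable X]setTI; apply: measurable_fun_le => //.
  by apply: measurableT_comp => //; exact: measurable_funP.
have pq : p <= q.
  rewrite /p /q /prob_abs_le fine_le ?fin_num_measure//.
  by rewrite le_measure ?inE// => w /=; lra.
have q1 : q <= 1.
  by rewrite /q /prob_abs_le -[leRHS]/(fine 1%E) fine_le ?fin_num_measure// probability_le1.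
have q0 : 0 < q by lra.
have s0 : 0 < s%:R :> R by rewrite ltr0n.
have [gam0 C1g] := C1_gap K1 hbeta hWalpha.
set gam := p * (beta - 1) / beta in gam0 C1g.
set c1 := C1 K beta p in C1g h8 *.
have c10 : 0 < c1.
  by rewrite -(pmulr_lgt0 _ gam0); lra.
have eE : eta K alpha L beta p M n s = c1 * r * s%:R by [].
set e := eta K alpha L beta p M n s in eE h8 *.
have e0 : 0 < e by rewrite eE !mulr_gt0.
have C2_ge0 : 0 <= C2 K L beta p s.
  by rewrite addr_ge0 ?mulr_ge0 ?sqrtr_ge0// addr_ge0 ?sqr_ge0.
(* Drop the two other nonnegative summands of [h8] and use [q <= 1]. *)
have h8' : 12 * L ^+ 3 * e <= 2^-1.
  have : 0 <= L * rt by rewrite mulr_ge0 ?ltW.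
  have : 0 <= C2 K L beta p s / (Num.sqrt n%:R * s%:R ^+ 2).
    by rewrite divr_ge0// mulr_ge0 ?sqrtr_ge0// sqr_ge0.
  lra.
have h7' : s%:R ^+ 2 * r <= 1.
  have sr0 : 0 < Num.sqrt r by rewrite sqrtr_gt0.
  rewrite -[X in _ * X](sqr_sqrtr (ltW r0)) -exprMn exprn_ile1//.
  by rewrite -ler_pdivlMr.
have Le0 : 0 < L * e by exact: mulr_gt0.
have [G [mG PG fG ThG]] := full_measure_bound_set hK L0 hfL.
(* The half-width of the kink windows is [L * e], which will dominate every [|f_Delta (Xs i w)|]
   once the l1 error is known to be at most [e]. *)
have [A [mA PA HA]] := deviation_event alpha hY hXW hWsym hiid hM n0 B0 L1 hl mG PG fG h5d Le0 h6.
exists A; split => //.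
  (* The event has probability at least [1 - M^-1]; the other subtracted terms are nonnegative, the
     logarithm because [n / ln M >= 1]. *)
  apply: le_trans PA; rewrite lee_fin.
  have h1 : 0 <= M%:R `^ (- K) by exact: powR_ge0.
  have h2' : 0 <= expR (- Num.sqrt (ln M%:R)) :> R by exact: expR_ge0.
  have h3' : 0 <= 3 * M%:R `^ (- (2 * K)) * ln (n%:R / ln M%:R).
    rewrite mulr_ge0 ?mulr_ge0 ?powR_ge0// ln_ge0//.
    have : 0 <= n%:R / ln M%:R :> R by rewrite divr_ge0 ?ltW.
    by move=> /sqr_sqrtr <-; rewrite exprn_ege1.
  lra.
move=> w Aw th [[Tth gth] thmin].
have [Gw grad_ts gramw kinkw] := HA w Aw.
have grE t j : gradient (emp_risk K alpha f (fun i => Xs i) (fun i => Ys i) w) t 0 j =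
    - (n%:R^-1 * \sum_(i < n) clip B (Ys i w - lincomb f t (Xs i w)) * f j (Xs i w)).
  by rewrite gradient_emp_riskE// ltW.
have feas : dantzig_feasible K alpha r X f (fun i => Xs i) (fun i => Ys i) w theta_star.
  split; first exact: h2.
  apply/rV_norm_leP; first exact: ltW.
  by move=> j; rewrite grE normrN; exact: grad_ts.
have cone := l1_minimal_cone (thmin _ feas).
pose noise i := Ys i w - lincomb f theta_star (Xs i w).
pose D j := th 0 j - theta_star 0 j.
pose F i j := f j (Xs i w).
have vE i : \sum_(j < M) D j * F i j = lincomb f th (Xs i w) - lincomb f theta_star (Xs i w).
  by rewrite /lincomb -sumrB; apply: eq_bigr => j _; rewrite mulrBl.
have vK i : `|\sum_(j < M) D j * F i j| <= 2 * K.
  rewrite vE (le_trans (ler_normB _ _))//.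
  by have := ThG _ _ (Gw i) Tth; have := ThG _ _ (Gw i) h2; lra.
have grad2 j : `|n%:R^-1 * \sum_(i < n)
    (clip B (noise i) - clip B (noise i - \sum_(j < M) D j * F i j)) * F i j| <= 2 * r.
  have := grad_ts j; have /(rV_norm_leP _ (ltW r0))/(_ j) := gth.
  rewrite grE normrN -rE => g1 g2.
  rewrite (_ : n%:R^-1 * _ =
    n%:R^-1 * (\sum_(i < n) clip B (noise i) * F i j) -
    n%:R^-1 * (\sum_(i < n) clip B (Ys i w - lincomb f th (Xs i w)) * f j (Xs i w))).
    rewrite (le_trans (ler_normB _ _))//.
    by move: g1 g2; rewrite /noise /F; lra.
  rewrite -mulrBr -sumrB; congr (_ * _); apply: eq_bigr => i _.
  by rewrite vE -mulrBl /noise opprB addrA subrK.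
have D1 : 0 <= \sum_(j < M) `|D j| <= e.
  apply/andP; split; first exact: sumr_ge0.
  (* The truncated Gram matrix is compared with [p] times the identity, so [eps] adds the coherence
     [p / (3 * beta * s)] to the sampling deviation. Two feasible gradients make the bound
     [2 * r]. *)
  have l1 := @cone_l1_bound R n M s F noise D _ B K alpha p gam
    (6 * L ^+ 2 * rt + p / (3 * beta * s%:R)) (2 * r) (ltW B0) erefl (ltW gam0).
  have b3 : 0 < 3 * beta * s%:R by rewrite mulr_gt0//; lra.
  have eps0 : 0 <= 6 * L ^+ 2 * rt + p / (3 * beta * s%:R).
    apply: addr_ge0; last exact: divr_ge0 (ltW hWalpha) (ltW b3).
    apply: mulr_ge0 (ltW rt0); apply: mulr_ge0 => //; exact: sqr_ge0.
  have {}l1 := l1 _ eps0 (mulr_ge0 (ler0n _ 2) (ltW r0)) vK grad2 _ hsparse cone.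
  have cond := restricted_coherence (erefl gam) hbeta gam0 L1 (ltW rt0) s0 rtr C1g.
  rewrite -eE in cond; have {}cond := cond h8'.
  have {l1 cond} : gam * \sum_(j < M) `|D j| <= 8 * (2 * r) * s%:R.
    apply: l1 cond => j l.
    rewrite (_ : _ - _ = (n%:R^-1 * (\sum_(i < n) (`|noise i| <= alpha)%R%:R * (F i j * F i l))
        - p * gram X f j l) + p * (gram X f j l - (j == l)%:R)); last by ring.
    rewrite (le_trans (ler_normD _ _))// lerD//.
      by apply: gramw; left.
    rewrite normrM (ger0_norm (ltW hWalpha)) ler_wpM2l ?(ltW hWalpha)//.
    have [<-|jl] := eqVneq j l; first by rewrite h5d subrr normr0 invr_ge0 ltW.
    by rewrite subr0 -[leRHS]mul1r h5o.
  (* Here [8 * (2 * r) * s = 16 * r * s], below [24 * r * s <= c1 * gam * r * s = gam * e]. *)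
  move=> l1; rewrite -(ler_pM2l gam0) (le_trans l1)// eE.
  have rs0 : 0 <= r * s%:R by rewrite mulr_ge0// ltW.
  have : 24 * (r * s%:R) <= c1 * gam * (r * s%:R) by rewrite ler_wpM2r.
  nra.
have coord j : `|(th - theta_star) 0 j| <= C4 K L beta p q s n * r.
  rewrite !mxE.
  apply: (@sup_error_arith R q beta L rt r s%:R c1 e _ (\sum_(j < M) `|D j|)) => //.
  - by rewrite q0 q1.
  - exact: ltW.
  - exact: ltW.
  - by rewrite divr_ge0// mulr_ge0// sqrtr_ge0.
  apply: (@coherence_sup_bound R n M F noise D (gram X f) B L q _ _ _ (L * e)) => //.
  - exact: ltW.
  - exact: ltW.
  - exact: ltW.
  - by rewrite divr_ge0// !mulr_ge0// ltW//; lra.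
  - by rewrite ler_wpM2l ?(ltW L0)//; case/andP: D1.
  - by move=> i k; exact: fG.
  - by move=> l; apply: gramw; right.
  - by move=> l lj; exact: h5o.
have Mpos : (0 < M)%N by exact: leq_trans hM.
(* The bound must be nonnegative to be compared with a sup norm; it dominates the modulus of
   coordinate 0, which exists as [M >= 2]. *)
apply/rV_norm_leP => //; exact: le_trans (normr_ge0 _) (coord (Ordinal Mpos)).
Qed.
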